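(* Let $(E,\mathcal E)$ be a Borel space, $\alpha$ a finite, non-zero measure on $E$, $p\in(0,1)$, and let $\rho$ be the Pascal distribution with parameters $\alpha$ and $p$. Then $$I_n\bigl(\mathbf 1_{B_1}^{\otimes d_1}\otimes\cdots\otimes\mathbf 1_{B_N}^{\otimes d_N},\eta\bigr)=\prod_{k=1}^N\mathscr M_{d_k}\bigl(\eta(B_k);\alpha(B_k);p\bigr)$$ for $\rho$-almost all $\eta\in\mathbf N_{<\infty}$, all $N\in\mathbb N$, all pairwise disjoint $B_1,\dots,B_N\in\mathcal E$, and all $n,d_1,\dots,d_N\in\mathbb N_0$ with $d_1+\dots+d_N=n$, where $I_n$ is the generalized orthogonal polynomial with respect to $\rho$ and $\mathscr M_d$ are the monic Meixner polynomials.
   Context: $\mathbf N_{<\infty}$ is the set of finite measures on $(E,\mathcal E)$ taking values in $\mathbb N_0$, with the $\sigma$-algebra $\mathcal N_{<\infty}$ generated by $\eta\mapsto\eta(B)$, $B\in\mathcal E$. The Pascal distribution with parameters $\alpha$ and $p\in(0,1)$ is the law $\rho$ on $\mathbf N_{<\infty}$ of a point process $\zeta$ such that $\zeta(B_1),\dots,\zeta(B_m)$ are independent for pairwise disjoint $B_1,\dots,B_m\in\mathcal E$ and, for each $B\in\mathcal E$, $\mathbb P(\zeta(B)=k)=(1-p)^{\alpha(B)}\,\alpha(B)(\alpha(B)+1)\cdots(\alpha(B)+k-1)\,\frac{p^k}{k!}$, $k\in\mathbb N_0$ (for $k=0$: $(1-p)^{\alpha(B)}$). Generalized orthogonal polynomials: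 $\mathcal P_n\subset L^2(\rho)$ is the set of linear combinations of maps $\eta\mapsto\int f_k\,\mathrm d\eta^{\otimes k}$, $0\le k\le n$, $f_k:E^k\to\mathbb R$ bounded measurable (constant functions for $k=0$), $\overline{\mathcal P_n}$ its closure in $L^2(\rho)$. For $n\ge1$ and $f_n:E^n\to\mathbb R$ bounded measurable, $I_n(f_n,\cdot)$ is the orthogonal projection in $L^2(\rho)$ of $\eta\mapsto\int f_n\,\mathrm d\eta^{\otimes n}$ onto $\overline{\mathcal P_{n-1}}^{\perp}$ (defined up to $\rho$-null sets). For $n=0$, $I_0(f_0,\cdot):=f_0\in\mathbb R$; an empty tensor product is the constant $1$. Monic Meixner polynomials: $\mathscr M_n(x;a;p):=\sum_{k=0}^n\binom nk\bigl(1-\tfrac1p\bigr)^{k-n}(a+k)^{(n-k)}(x)_k$ for $x,n\in\mathbb N_0$, $a>0$, with $(b)^{(j)}:=b(b+1)\cdots(b+j-1)$, $(b)^{(0)}:=1$, and $(b)_j:=b(b-1)\cdots(b-j+1)$, $(b)_0:=1$. The same formula is used when $a=0$. *)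

(* Defs.v *)
From HB Require Import structures.
From mathcomp Require Import all_boot all_order all_algebra.
From mathcomp Require Import all_classical all_reals all_analysis.
From mathcomp Require Import measurable_realfun.

Set Implicit Arguments.
Unset Strict Implicit.
Unset Printing Implicit Defensive.

Import Order.TTheory GRing.Theory Num.Theory.
Import numFieldNormedType.Exports.

Local Open Scope classical_set_scope.
Local Open Scope ring_scope.

(* A Borel space is a measurable space isomorphic to a Borel subset of [0, 1]. *)
Definition borel_space (R : realType) d (E : measurableType d) : Prop :=
  exists (f : E -> R) (g : R -> E),
    [/\ measurable_fun [set: E] f,
        measurable (range f),
        range f `<=` `[0, 1],
        measurable_fun (range f) g
      & cancel f g].

Section powers_of_measures.
Local Open Scope ereal_scope.
Context d (E : measurableType d) (R : realType).

Definition cons_pair n (z : E * n.-tuple E) : n.+1.-tuple E :=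
  [tuple of z.1 :: z.2].

Lemma measurable_cons_pair n : measurable_fun setT (@cons_pair n).
Proof.
exact: (measurable_cons (f := @fst E _) measurable_fst measurable_snd).
Qed.

HB.instance Definition _ n :=
  isMeasurableFun.Build _ _ _ _ (@cons_pair n) (@measurable_cons_pair n).

Definition cons_measure n (m1 : {finite_measure set E -> \bar R})
    (m2 : {finite_measure set (n.-tuple E) -> \bar R}) :
    set (n.+1.-tuple E) -> \bar R :=
  pushforward (m1 \x m2) (@cons_pair n).

Section cons_measure_instance.
Variables (n : nat) (m1 : {finite_measure set E -> \bar R}).
Variable m2 : {finite_measure set (n.-tuple E) -> \bar R}.

Let cons_measure0 : cons_measure m1 m2 set0 = 0.
Proof. exact: measure0. Qed.

Let cons_measure_ge0 A : 0 <= cons_measure m1 m2 A.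
Proof. exact: measure_ge0. Qed.

Let cons_measure_sigma_additive : semi_sigma_additive (cons_measure m1 m2).
Proof. exact: measure_semi_sigma_additive. Qed.

HB.instance Definition _ := isMeasure.Build _ _ _ (cons_measure m1 m2)
  cons_measure0 cons_measure_ge0 cons_measure_sigma_additive.

Let cons_measure_fin : fin_num_fun (cons_measure m1 m2).
Proof.
have fT : cons_measure m1 m2 setT \is a fin_num.
  rewrite /cons_measure /pushforward /= preimage_setT -setXTT.
  by rewrite product_measure1E// fin_numM// fin_num_measure.
move=> A mA; rewrite ge0_fin_numE//.
apply: (@le_lt_trans _ _ (cons_measure m1 m2 setT)).
  by apply: le_measure; rewrite ?inE.
by rewrite -ge0_fin_numE.
Qed.

HB.instance Definition _ :=
  Measure_isFinite.Build _ _ _ (cons_measure m1 m2) cons_measure_fin.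
End cons_measure_instance.

(* For n = 0 this is the unit mass at the empty tuple, so that the integral of a
   function on E^0 is its (constant) value. *)
Fixpoint mpower (mu : {finite_measure set E -> \bar R}) n :
    {finite_measure set (n.-tuple E) -> \bar R} :=
  if n is m.+1 then cons_measure mu (mpower mu m) else \d_([tuple] : 0.-tuple E).

End powers_of_measures.

(* Two elements may differ on non-measurable sets; the sigma-algebra below does
   not separate them. *)
Record nmeasure d (E : measurableType d) (R : realType) := NMeasure {
  nmeasure_val :> {finite_measure set E -> \bar R};
  nmeasure_nat : forall B, measurable B ->
    exists k : nat, nmeasure_val B = k%:R%:E }.

Section nmeasure_sigma_algebra.
Context d (E : measurableType d) (R : realType).
Local Notation N := (nmeasure E R).

Let nmeasure0 : N.
Proof.
have fin : fin_num_fun (@mzero d E R) by move=> A mA.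
pose mixin := Measure_isFinite.Build _ _ _ (@mzero d E R) fin.
pose m0 : {finite_measure set E -> \bar R} :=
  HB.pack (@mzero d E R) mixin.
by apply: (@NMeasure _ _ _ m0) => B mB; exists 0%N.
Qed.

HB.instance Definition _ := gen_eqMixin N.
HB.instance Definition _ := gen_choiceMixin N.
HB.instance Definition _ := isPointed.Build N nmeasure0.

Definition nmeasure_measurable : set_system N :=
  <<s \bigcup_(B in measurable)
        preimage_set_system [set: N] (fun eta : N => eta B) measurable >>.

Definition nmeasure_display : measure_display.
Proof. by constructor. Qed.

Let nmeasurable0 : nmeasure_measurable set0.
Proof. exact: sigma_algebra0. Qed.

Let nmeasurableC A : nmeasure_measurable A -> nmeasure_measurable (~` A).
Proof. exact: sigma_algebraC. Qed.

Let nmeasurableU (F : (set N)^nat) :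
  (forall i, nmeasure_measurable (F i)) -> nmeasure_measurable (\bigcup_i F i).
Proof. exact: sigma_algebra_bigcup. Qed.

HB.instance Definition _ := @isMeasurable.Build nmeasure_display N
  nmeasure_measurable nmeasurable0 nmeasurableC nmeasurableU.

End nmeasure_sigma_algebra.

Section pascal.
Context (R : realType).

Definition rising (b : R) (j : nat) : R := \prod_(i < j) (b + i%:R).

Definition falling (b : R) (j : nat) : R := \prod_(i < j) (b - i%:R).

Definition pascal_pmf (a p : R) (k : nat) : R :=
  (1 - p) `^ a * rising a k * (p ^+ k / k`!%:R).

(* The product rule for subfamilies is the case where some [A i] are [setT]. *)
Definition mutually_independent d (Omega : measurableType d)
    d' (T : measurableType d') (P : probability Omega R)
    m (X : 'I_m -> Omega -> T) : Prop :=
  forall A : 'I_m -> set T, (forall i, measurable (A i)) ->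
    P (\bigcap_i (X i @^-1` A i)) = (\prod_(i < m) P (X i @^-1` A i))%E.

Context d (E : measurableType d).

Definition pascal_process (alpha : {finite_measure set E -> \bar R}) (p : R)
    d' (Omega : measurableType d') (P : probability Omega R)
    (zeta : {mfun Omega >-> nmeasure E R}) : Prop :=
  (forall m (B : 'I_m -> set E),
     (forall i, measurable (B i)) -> trivIset [set: 'I_m] B ->
     mutually_independent P (fun i w => zeta w (B i))) /\
  (forall B k, measurable B ->
     P [set w | zeta w B = k%:R%:E] = (pascal_pmf (fine (alpha B)) p k)%:E).

Definition pascal_distribution (alpha : {finite_measure set E -> \bar R})
    (p : R) (rho : probability (nmeasure E R) R) : Prop :=
  exists d' (Omega : measurableType d') (P : probability Omega R)
         (zeta : {mfun Omega >-> nmeasure E R}),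
    pascal_process alpha p P zeta /\
    forall A, measurable A -> rho A = distribution P zeta A.

End pascal.

(* Elements of L^2(mu) are represented by square integrable functions; a.e.
   equal functions are not identified. *)
Section L2.
Context d (T : measurableType d) (R : realType).
Variable mu : {measure set T -> \bar R}.

Definition L2_closure (M : set (T -> R)) : set (T -> R) :=
  [set h | h \in Lfun mu 2%:E /\
    forall e : R, 0 < e ->
      exists2 g, M g & ('N[mu]_2%:E[EFin \o (h \- g)%R] < e%:E)%E].

Definition L2_orthogonal (M : set (T -> R)) : set (T -> R) :=
  [set h | h \in Lfun mu 2%:E /\
    forall g, M g -> \int[mu]_x (h x * g x) = 0].

Definition L2_projection (M : set (T -> R)) (g h : T -> R) : Prop :=
  M h /\ L2_orthogonal M (fun x => g x - h x).

End L2.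

Definition linear_combinations (T : Type) (R : realType) (A : set (T -> R)) :
    set (T -> R) :=
  [set g | exists m (c : 'I_m -> R) (u : 'I_m -> T -> R),
     (forall i, A (u i)) /\ g = fun x => \sum_(i < m) c i * u i x].

Section orthogonal_polynomials.
Context d (E : measurableType d) (R : realType).

Definition bounded_measurable k (f : k.-tuple E -> R) : Prop :=
  measurable_fun setT f /\ exists C : R, forall x, `|f x| <= C.

Definition power_integral k (f : k.-tuple E -> R) (eta : nmeasure E R) : R :=
  \int[mpower eta k]_x f x.

Definition polynomials (n : nat) : set (nmeasure E R -> R) :=
  linear_combinations
    [set g | exists k (f : k.-tuple E -> R),
       [/\ (k <= n)%N, bounded_measurable f & g = power_integral f]].

Variable rho : probability (nmeasure E R) R.

(* A version of I_n(f, .), which for n > 0 is defined up to rho-null sets. If no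
   projection existed the default value of [xget] would be returned. *)
Definition orthogonal_polynomial (n : nat) :
    (n.-tuple E -> R) -> nmeasure E R -> R :=
  match n with
  | 0 => fun f _ => f [tuple]
  | m.+1 => fun f =>
      xget (cst 0)
        [set h | L2_projection rho
                   (L2_orthogonal rho (L2_closure rho (polynomials m)))
                   (power_integral f) h]
  end.

End orthogonal_polynomials.

Section meixner.
Context (R : realType).

Definition meixner (n : nat) (x a p : R) : R :=
  \sum_(k < n.+1) 'C(n, k)%:R * (1 - p^-1) ^ (k%:Z - n%:Z) *
    rising (a + k%:R) (n - k) * falling x k.

End meixner.

Section tensor_products.
Context d (E : measurableType d) (R : realType).

Definition tensor n (f : 'I_n -> E -> R) (x : n.-tuple E) : R :=
  \prod_(i < n) f i (tnth x i).

(* The list B_1, ..., B_1, ..., B_N, ..., B_N with B_k repeated d_k times. *)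
Definition blocks N (B : 'I_N -> set E) (dd : 'I_N -> nat) : seq (set E) :=
  flatten [seq nseq (dd k) (B k) | k <- enum 'I_N].

Definition block_indic n N (B : 'I_N -> set E) (dd : 'I_N -> nat) :
    n.-tuple E -> R :=
  tensor (fun i : 'I_n => \1_(nth set0 (blocks B dd) i)).

End tensor_products.

(* Main.v *)
(** Let h be the product of the Meixner polynomials M_(d_k)(eta(B_k)). It differs
    from the product of the eta(B_k)^(d_k) by a polynomial in counts of degree
    less than n, so it suffices that h is orthogonal to every polynomial of
    degree k < n; by a monotone class argument the test polynomial may be taken
    to be eta(A_1)...eta(A_k).

    The A_i are removed one at a time. For a partition C_1, ..., C_m of E refining
    the B_k one has eta(A) = sum_j eta(C_j /\ A), and in the j-th summand only
    C_j needs to be split, into C_j /\ A and C_j \ A. The addition formula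
      M_n(x + y; a + b) = sum_i 'C(n, i) M_i(x; a) M_(n - i)(y; b)
    keeps the integrand a combination of products of
    M_(e_j)(eta(C_j)) eta(C_j)^(m_j) with sum_j m_j < sum_j e_j. By independence
    the expectation of such a product factorizes, and some j has m_j < e_j, so
    that this factor vanishes by the one-dimensional orthogonality of M_(e_j) to
    lower powers under the negative binomial law. *)
Require Import Defs.
From mathcomp Require Import all_boot all_order all_algebra.
From mathcomp Require Import all_classical all_reals all_analysis.
From mathcomp Require Import measurable_realfun ring lra zify.

Set Implicit Arguments.
Unset Strict Implicit.
Unset Printing Implicit Defensive.

Import Order.TTheory GRing.Theory Num.Theory.
Import numFieldNormedType.Exports.

Local Open Scope classical_set_scope.
Local Open Scope ring_scope.

(** * Binomial convolutions, rising and falling factorials *)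

Section binomial_convolution.
Context (R : realType).
Implicit Types (u v w : nat -> R) (a b x q : R) (n : nat).

(** The coefficients of a product of exponential generating functions. The addition formulas for
    [rising] and [meixner] both have this form. *)
Definition binconv u v n : R := \sum_(i < n.+1) 'C(n, i)%:R * u i * v (n - i)%N.

Lemma eq_binconv u u' v v' n : u =1 u' -> v =1 v' -> binconv u v n = binconv u' v' n.
Proof. by move=> eu ev; apply: eq_bigr => i _; rewrite eu ev. Qed.

Lemma binconvC u v n : binconv u v n = binconv v u n.
Proof.
rewrite /binconv (reindex_inj rev_ord_inj) /=; apply: eq_bigr => i _.
have lein : (i <= n)%N by rewrite -ltnS.
by rewrite subSS bin_sub // subKn // -!mulrA (mulrC (u _)).
Qed.

(** Pascal's rule. On generating functions this is the Leibniz rule, the shift of a sequence being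
    the derivative. *)
Lemma binconvS u v n :
  binconv u v n.+1 = binconv (fun i => u i.+1) v n + binconv u (fun i => v i.+1) n.
Proof.
rewrite /binconv big_ord_recl /= bin0 subn0.
under eq_bigr => i _ do rewrite /bump /= add1n binS natrD subSS !mulrDl.
rewrite big_split /= addrA addrC; congr (_ + _).
rewrite big_ord_recr /= bin_small // !mul0r addr0 [RHS]big_ord_recl /= bin0 subn0.
congr (_ + _); apply: eq_bigr => i _.
by rewrite /bump /= add1n -subSn //= subSS.
Qed.

(** On generating functions both sides are a multiplication by the variable. At index [0] the factor
    [0] cancels the spurious value of [.-1]. *)
Lemma binconv_derl u v n :
  binconv (fun i => i%:R * u i.-1) v n = n%:R * binconv u v n.-1.
Proof.
case: n => [|n]; first by rewrite /binconv big_ord1 /=; ring.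
rewrite /binconv big_ord_recl /= mul0r mulr0 mul0r add0r mulr_sumr.
apply: eq_bigr => i _; rewrite /bump /= add1n subSS !mulrA; congr (_ * _ * _).
by rewrite -!natrM -[n in RHS]/(n.+1.-1) mul_bin_diag mulnC.
Qed.

Lemma binconvDl u u' v n :
  binconv (fun i => u i + u' i) v n = binconv u v n + binconv u' v n.
Proof. by rewrite -big_split; apply: eq_bigr => i _ /=; ring. Qed.

Lemma rising_recr b j : rising b j.+1 = rising b j * (b + j%:R).
Proof. by rewrite /rising big_ord_recr. Qed.

Lemma rising_recl b j : rising b j.+1 = b * rising (b + 1) j.
Proof.
rewrite /rising big_ord_recl addr0; congr (_ * _); apply: eq_bigr => i _.
by rewrite /bump /= natrD addrA.
Qed.

Lemma rising_addn b i j : rising b (i + j) = rising b i * rising (b + i%:R) j.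
Proof.
elim: j => [|j IH]; first by rewrite addn0 /rising big_ord0 mulr1.
by rewrite addnS !rising_recr IH natrD; ring.
Qed.

Lemma rising_ge0 b j : 0 <= b -> 0 <= rising b j.
Proof. by move=> b0; apply: prodr_ge0 => i _; rewrite addr_ge0. Qed.

Lemma risingD1 b j : rising (b + 1) j = rising b j + j%:R * rising (b + 1) j.-1.
Proof.
case: j => [|j]; first by rewrite /rising !big_ord0 mul0r addr0.
rewrite rising_recr rising_recl /= -addn1 natrD; ring.
Qed.

Lemma falling_recr b j : falling b j.+1 = falling b j * (b - j%:R).
Proof. by rewrite /falling big_ord_recr. Qed.

Lemma falling_recl b j : falling b j.+1 = b * falling (b - 1) j.
Proof.
rewrite /falling big_ord_recl subr0; congr (_ * _); apply: eq_bigr => i _.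
by rewrite /bump /= natrD opprD addrA.
Qed.

Lemma fallingD1 b j : falling (b + 1) j = falling b j + j%:R * falling b j.-1.
Proof.
case: j => [|j]; first by rewrite /falling !big_ord0 mul0r addr0.
rewrite falling_recl falling_recr /= addrK -addn1 natrD; ring.
Qed.

(** The Chu-Vandermonde identity. In the induction the new factor [a + b + n] splits in the [i]-th
    term as [(a + i) + (b + (n - i))], which matches [binconvS]. *)
Lemma risingD a b n : rising (a + b) n = binconv (rising a) (rising b) n.
Proof.
elim: n => [|n IH]; first by rewrite /binconv big_ord1 /rising !big_ord0 bin0 !mulr1.
rewrite rising_recr IH binconvS /binconv mulr_suml -big_split /=.
apply: eq_bigr => i _; rewrite !rising_recr.
have lein : (i <= n)%N by rewrite -ltnS.
by rewrite (natrB _ lein); ring.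
Qed.

(** An [n]-th finite difference of a polynomial in [k] of degree [j < n]: [binconvS] pairs
    consecutive terms of opposite sign, and [risingD1] lowers the degree by one. *)
Lemma alternating_sum_rising b n j : (j < n)%N ->
  \sum_(k < n.+1) 'C(n, k)%:R * (-1) ^+ k * rising (b + k%:R) j = 0.
Proof.
have E c m i : \sum_(k < m.+1) 'C(m, k)%:R * (-1) ^+ k * rising (c + k%:R) i =
    binconv (fun k => (-1) ^+ k * rising (c + k%:R) i) (fun=> 1) m.
  by apply: eq_bigr => k _; ring.
elim: n j b => [//|n IH] j b jn.
rewrite E binconvS; transitivity (- j%:R *
    binconv (fun k => (-1) ^+ k * rising (b + 1 + k%:R) j.-1) (fun=> 1) n).
  rewrite /binconv -big_split mulr_sumr; apply: eq_bigr => k _ /=.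
  rewrite -(addn1 k) natrD addrA (risingD1 (b + k%:R)) (addrAC b) addn1 exprS; ring.
case: j jn => [|j] jn; first by rewrite oppr0 mul0r.
by rewrite -E IH ?mulr0.
Qed.

End binomial_convolution.

(** * The addition formula for the Meixner polynomials *)

Section meixner_algebra.
Context (R : realType).
Implicit Types (a b x p : R) (n : nat).

Lemma meixnerE n x a p : meixner n x a p =
  \sum_(k < n.+1) 'C(n, k)%:R * ((1 - p^-1)^-1) ^+ (n - k) *
    rising (a + k%:R) (n - k) * falling x k.
Proof.
apply: eq_bigr => k _; congr (_ * _ * _ * _).
have lekn : (k <= n)%N by rewrite -ltnS.
by rewrite -(opprB n%:Z) subzn // -exprnN exprVn.
Qed.

(** The difference rule that drives the induction in [meixnerD]. It follows termwise from
    [fallingD1]; lowering the index turns [a + k] into [(a + 1) + (k - 1)], whence the raised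
    parameter. *)
Lemma meixnerD1 n x a p :
  meixner n (x + 1) a p = meixner n x a p + n%:R * meixner n.-1 x (a + 1) p.
Proof.
rewrite !meixnerE; case: n => [|n].
  by rewrite mul0r addr0 !big_ord1 /falling !big_ord0.
under eq_bigr => k _ do rewrite fallingD1 mulrDr.
rewrite big_split /=; congr (_ + _); rewrite big_ord_recl /= mul0r mulr0 add0r.
rewrite mulr_sumr; apply: eq_bigr => i _; rewrite /bump /= add1n subSS.
have E : 'C(n.+1, i.+1)%:R * i.+1%:R = n.+1%:R * 'C(n, i)%:R :> R.
  by rewrite -!natrM -[n in RHS]/(n.+1.-1) mul_bin_diag mulnC.
have -> : a + 1 + i%:R = a + i.+1%:R by rewrite -(addn1 i) natrD; ring.
transitivity (('C(n.+1, i.+1)%:R * i.+1%:R) * (1 - p^-1)^-1 ^+ (n - i) *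
  rising (a + i.+1%:R) (n - i) * falling x i); first by ring.
by rewrite E; ring.
Qed.

Lemma meixner_at0 n a p : meixner n 0 a p = (1 - p^-1)^-1 ^+ n * rising a n.
Proof.
rewrite meixnerE big_ord_recl /= bin0 subn0 addr0 /falling big_ord0.
rewrite big1 ?addr0; first by ring.
by move=> i _; rewrite big_ord_recl subr0 mul0r mulr0.
Qed.

Lemma meixnerD n (x y : nat) a b p : meixner n (x + y)%:R (a + b) p =
  binconv (fun i => meixner i x%:R a p) (fun i => meixner i y%:R b p) n.
Proof.
(* Induction on [w] starting from the case of argument [0]: by [meixnerD1] and [binconv_derl] both
   sides have the same increment. *)
have step (z : nat) : (forall n a b, meixner n z%:R (a + b) p =
    binconv (fun i => meixner i 0 a p) (fun i => meixner i z%:R b p) n) ->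
    forall w n a b, meixner n (w + z)%:R (a + b) p =
      binconv (fun i => meixner i w%:R a p) (fun i => meixner i z%:R b p) n.
  move=> H0; elim=> [|w IH] m a' b'; first exact: H0.
  rewrite addSn -addn1 natrD meixnerD1 IH (addrAC a' b' 1) IH -binconv_derl -binconvDl.
  by apply: eq_binconv => i //; rewrite -(addn1 w) natrD meixnerD1.
(* The induction runs first in [x] and then, after the two factors are exchanged, in [y]. With both
   arguments zero, [meixner_at0] reduces the claim to [risingD]. *)
apply: (step) => {}n {}a {}b; rewrite addrC binconvC -[y in LHS]addn0.
apply: (step) => {}n {}a {}b; rewrite meixner_at0 risingD /binconv mulr_sumr.
apply: eq_bigr => i _; rewrite !meixner_at0.
have lein : (i <= n)%N by rewrite -ltnS.
by rewrite -{1}(subnKC lein) exprD; ring.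
Qed.

Lemma meixner0 x a p : meixner 0 x a p = 1.
Proof. by rewrite meixnerE big_ord1 /rising /falling !big_ord0 bin0 !mulr1. Qed.

End meixner_algebra.

(** * Moments and orthogonality under the negative binomial weights *)

Section negative_binomial.
Context (R : realType) (a p : R).
Hypotheses (a0 : 0 <= a) (p0 : 0 < p) (p1 : p < 1).
(** Supplied later by [pascal_mass_le1], where the weights are point probabilities under [rho]. *)
Hypothesis bounded_mass : forall m, \sum_(k < m) pascal_pmf a p k <= 1.

Let w := pascal_pmf a p.
Let mom (f : nat -> R) : R^nat := fun m => \sum_(k < m) f k * w k.
Let T k j (x : nat) : R := falling x%:R k * rising (a + x%:R) j.

Lemma pascal_pmf_ge0 k : 0 <= pascal_pmf a p k.
Proof.
rewrite /pascal_pmf !mulr_ge0 ?powR_ge0 ?rising_ge0 ?invr_ge0 ?exprn_ge0 //.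
exact: ltW.
Qed.

Let pmfS k : k.+1%:R * w k.+1 = p * ((a + k%:R) * w k).
Proof.
rewrite /w /pascal_pmf rising_recr factS natrM exprS.
have f0 : k`!%:R != 0 :> R by rewrite pnatr_eq0 -lt0n fact_gt0.
have k0 : 1 + k%:R != 0 :> R by rewrite addrC natr1 pnatr_eq0.
by rewrite -natr1; field; rewrite f0 addrC.
Qed.

(** The term at [0] vanishes and the recursion of the weights moves the index by one, which is why
    the two truncations differ by one. *)
Let mom_shift (f : nat -> R) m :
  mom (fun k => k%:R * f k) m.+1 = p * mom (fun k => (a + k%:R) * f k.+1) m.
Proof.
rewrite /mom big_ord_recl !mul0r add0r mulr_sumr; apply: eq_bigr => k _.
rewrite lift0.
by transitivity (f k.+1 * (k.+1%:R * w k.+1)); [ring|rewrite pmfS; ring].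
Qed.

Let momD f g m : mom (fun k => f k + g k) m = mom f m + mom g m.
Proof. by rewrite -big_split; apply: eq_bigr => k _ /=; ring. Qed.

Let momZ c f m : mom (fun k => c * f k) m = c * mom f m.
Proof. by rewrite mulr_sumr; apply: eq_bigr => k _ /=; ring. Qed.

Let eq_mom f g m : f =1 g -> mom f m = mom g m.
Proof. by move=> fg; apply: eq_bigr => k _; rewrite fg. Qed.

(* Both recursions come from (k + 1) w(k + 1) = p (a + k) w(k); they give convergence of
   the moments without summing the binomial series. *)
Let mom_falling k j m : mom (T k.+1 j) m.+1 = p * mom (T k j.+1) m.
Proof.
rewrite -[RHS]/(p * mom _ _).
transitivity (mom (fun x => x%:R * (falling (x%:R - 1) k * rising (a + x%:R) j)) m.+1).
  by apply: eq_mom => x; rewrite /T falling_recl mulrA.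
rewrite mom_shift; congr (_ * _); apply: eq_mom => x.
by rewrite /T rising_recl -natr1 addrK addrA; ring.
Qed.

Let mom_rising j m :
  mom (T 0 j.+1) m.+1 = (a + j%:R) * mom (T 0 j) m.+1 + p * mom (T 0 j.+1) m.
Proof.
rewrite -mom_falling -momZ -momD; apply: eq_mom => x.
rewrite /T rising_recr falling_recl /falling !big_ord0; ring.
Qed.

(** [L] is the limit of the partial masses. For [k = 0] the partial sums increase in [m], and
    [mom_rising] yields first their boundedness and then, in the limit, the ratio of consecutive
    moments. [mom_falling] trades each falling factor for [p] and one more rising factor. *)
Let mom_T_cvg : exists L : R, forall k j,
  mom (T k j) @ \oo --> p ^+ k * (1 - p)^-1 ^+ (k + j) * rising a (k + j) * L.
Proof.
have q0 : 0 < 1 - p by rewrite subr_gt0.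
have nd j : {homo mom (T 0 j) : m n / (m <= n)%N >-> m <= n}.
  apply/nondecreasing_seqP => m; rewrite {2}/mom big_ord_recr /= lerDl.
  rewrite mulr_ge0 ?pascal_pmf_ge0 // /T /falling big_ord0 mul1r.
  by rewrite rising_ge0 // addr_ge0.
have bd j : exists C, forall m, mom (T 0 j) m <= C.
  elim: j => [|j [C IH]].
    exists 1 => m; apply: le_trans (bounded_mass m).
    by apply: ler_sum => k _; rewrite /T /falling /rising !big_ord0 !mul1r.
  (* The value at [m] is at most that at [m.+1], so [mom_rising] bounds [1 - p] times it by
     [(a + j) * C]. *)
  exists ((a + j%:R) * C / (1 - p)) => m; rewrite ler_pdivlMr //.
  have E := mom_rising j m.
  have le1 := nd j.+1 _ _ (leqnSn m).
  have : (a + j%:R) * mom (T 0 j) m.+1 <= (a + j%:R) * C.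
    by rewrite ler_wpM2l // addr_ge0.
  nra.
have [L0 cvL0] : exists L : R, mom (T 0 0) @ \oo --> L.
  have [C bC] := bd 0%N.
  suff /cvg_ex[L cL] : cvgn (mom (T 0 0)) by exists L.
  by apply: nondecreasing_is_cvgn => //; exists C => _ [m _ <-].
have base j : mom (T 0 j) @ \oo --> (1 - p)^-1 ^+ j * rising a j * L0.
  elim: j => [|j IH].
    by rewrite expr0 /rising big_ord0 !mul1r.
  have [C bC] := bd j.+1.
  have cv : cvgn (mom (T 0 j.+1)).
    by apply: nondecreasing_is_cvgn => //; exists C => _ [m _ <-].
  have cvS : mom (T 0 j.+1) m.+1 @[m --> \oo] -->
     (a + j%:R) * ((1 - p)^-1 ^+ j * rising a j * L0) + p * lim (mom (T 0 j.+1) @ \oo).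
    under eq_cvg do rewrite mom_rising.
    apply: cvgD; last exact: cvgMl_tmp.
    by apply: cvgMl_tmp; rewrite (cvg_shiftS (mom (T 0 j))).
  (* Both sides of [mom_rising] converge, and the limit solves a linear equation with coefficient
     [1 - p]. *)
  have E : lim (mom (T 0 j.+1) @ \oo) =
      (a + j%:R) * ((1 - p)^-1 ^+ j * rising a j * L0) + p * lim (mom (T 0 j.+1) @ \oo).
    have cv' : mom (T 0 j.+1) m.+1 @[m --> \oo] --> lim (mom (T 0 j.+1) @ \oo).
      by rewrite (cvg_shiftS (mom (T 0 j.+1))).
    exact: (cvg_unique _ cv' cvS).
  suff -> : (1 - p)^-1 ^+ j.+1 * rising a j.+1 * L0 = lim (mom (T 0 j.+1) @ \oo) by [].
  have E2 : (1 - p) * lim (mom (T 0 j.+1) @ \oo) =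
      (a + j%:R) * ((1 - p)^-1 ^+ j * rising a j * L0).
    by rewrite mulrBl mul1r {1}E addrK.
  apply: (mulfI (lt0r_neq0 q0)); rewrite E2.
  by rewrite rising_recr exprS; field; rewrite gt_eqF.
exists L0; elim=> [|k IH] j.
  by rewrite expr0 mul1r; exact: base.
rewrite -cvg_shiftS.
have -> : [sequence mom (T k.+1 j) n.+1]_n = (fun m => p * mom (T k j.+1) m).
  by apply/funext => m; exact: mom_falling.
rewrite exprS -!mulrA addSnnS; apply: cvgMl_tmp.
by rewrite !mulrA.
Qed.

Let eq_cvgn (u v : R^nat) : u =1 v -> cvgn u -> cvgn v.
Proof. by move=> /funext->. Qed.

Let eq_cvgn_to (u v : R^nat) (l : R) : u =1 v -> u @ \oo --> l -> v @ \oo --> l.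
Proof. by move=> /funext->. Qed.

(** Induction on the power, for all [j] at once: one factor [x] is written as
    [(a + x + j) - (a + j)], and [a + x + j] is absorbed by the rising factorial. *)
Lemma cvg_pascal_moment i : cvgn (fun m => \sum_(k < m) k%:R ^+ i * pascal_pmf a p k).
Proof.
have [L cvT] := mom_T_cvg.
suff /(_ i 0%N) : forall i j, cvgn (mom (fun x => x%:R ^+ i * T 0 j x)).
  move=> H. refine (eq_cvgn _ H) => m; apply: eq_bigr => x _.
  by rewrite /T /falling /rising !big_ord0 !mulr1.
elim=> [|k IH] j.
  have := cvT 0%N j.
  move=> /cvgP H; refine (eq_cvgn _ H) => m; apply: eq_mom => x.
  by rewrite expr0 mul1r.
have H : cvgn (fun m => mom (fun x => x%:R ^+ k * T 0 j.+1 x) m -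
    (a + j%:R) * mom (fun x => x%:R ^+ k * T 0 j x) m).
  by apply: is_cvgB; [exact: IH|apply: is_cvgMl_tmp; exact: IH].
refine (eq_cvgn _ H) => m /=; rewrite -momZ -mulN1r -momZ -momD.
apply: eq_mom => x; rewrite /T rising_recr exprS; ring.
Qed.

(* Against the rising factorials of a + x, instead of powers of x, the mixed moments
   mom_T_cvg factorize and the claim becomes a vanishing n-th finite difference. *)
Lemma meixner_orthogonal n i : (i < n)%N ->
  \sum_(k < m) meixner n k%:R a p * k%:R ^+ i * pascal_pmf a p k @[m --> \oo] --> 0.
Proof.
have [L cvT] := mom_T_cvg.
have q0 : 1 - p != 0 by rewrite gt_eqF // subr_gt0.
move=> ilt; have : (i + 0 < n)%N by rewrite addn0.
(* Powers are traded for rising factorials as in [cvg_pascal_moment]; one power becomes at most one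
   rising factor, so [i + j] does not grow. *)
suff : forall i j, (i + j < n)%N ->
    mom (fun x => meixner n x%:R a p * x%:R ^+ i * rising (a + x%:R) j) @ \oo --> 0.
  move=> /[apply] H; refine (eq_cvgn_to _ H) => m; apply: eq_bigr => x _.
  by rewrite /rising big_ord0 mulr1.
elim=> [|k IH] j; last first.
  rewrite addSnnS => kj1; have kj : (k + j < n)%N by apply: ltnW; rewrite -addnS.
  have := cvgB (IH _ kj1) (cvgMl_tmp (a := a + j%:R) (IH _ kj)).
  rewrite mulr0 subr0 => H; refine (eq_cvgn_to _ (H _ _)) => m /=.
  rewrite !fctE -momZ -mulN1r -momZ -momD; apply: eq_mom => x.
  rewrite rising_recr exprS; ring.
move=> jn.
pose q := (1 - p^-1)^-1.
(* The right-hand side is the termwise limit given by [mom_T_cvg]. As [q = - p / (1 - p)], the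
   factors [q ^+ (n - k)] and [p ^+ k * (1 - p)^-1 ^+ k] combine to [q ^+ n * (-1) ^+ k], and the
   alternating sum remains. *)
have -> : 0 = \sum_(k < n.+1) 'C(n, k)%:R * q ^+ (n - k) * rising (a + k%:R) (n - k) *
     (p ^+ k * (1 - p)^-1 ^+ (k + j) * rising a (k + j) * L).
  transitivity (L * (1 - p)^-1 ^+ j * q ^+ n * rising a n *
      \sum_(k < n.+1) 'C(n, k)%:R * (-1) ^+ k * rising (a + k%:R) j).
    by rewrite alternating_sum_rising // mulr0.
  rewrite mulr_sumr; apply: eq_bigr => k _.
  have lekn : (k <= n)%N by rewrite -ltnS.
  have -> : q ^+ n = q ^+ (n - k) * q ^+ k by rewrite -exprD subnK.
  have -> : rising a n = rising a k * rising (a + k%:R) (n - k).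
    by rewrite -rising_addn subnKC.
  rewrite (rising_addn a k j) exprD.
  have H : q ^+ k * (-1) ^+ k = p ^+ k * (1 - p)^-1 ^+ k.
    rewrite -!exprMn; congr (_ ^+ _); rewrite /q; field.
    by rewrite q0 gt_eqF //= -opprB oppr_eq0 q0.
  transitivity (L * (1 - p)^-1 ^+ j * q ^+ (n - k) * (q ^+ k * (-1) ^+ k) *
    (rising a k * rising (a + k%:R) (n - k)) * ('C(n, k)%:R * rising (a + k%:R) j)).
    by ring.
  rewrite H; ring.
have -> : mom (fun x => meixner n x%:R a p * x%:R ^+ 0 * rising (a + x%:R) j) =
   \sum_(k < n.+1) (fun m =>
     'C(n, k)%:R * q ^+ (n - k) * rising (a + k%:R) (n - k) * mom (T k j) m).
  apply/funext => m.
  rewrite fct_sumE.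
  under eq_bigr do rewrite -momZ.
  rewrite exchange_big; apply: eq_bigr => x _ /=.
  rewrite meixnerE expr0 mulr1 !mulr_suml.
  by apply: eq_bigr => k _; rewrite /T; ring.
under eq_cvg do rewrite fct_sumE.
apply: cvg_big => [|k _]; first exact: add_continuous.
by apply: cvgMl_tmp; exact: cvT.
Qed.

End negative_binomial.

(** * Integrals of real-valued functions *)

Section real_integral.
Context d (T : measurableType d) (R : realType) (mu : {measure set T -> \bar R}).

Lemma integrable_EFin_sum (I : Type) (s : seq I) (f : I -> T -> R) :
  (forall i, mu.-integrable setT (EFin \o f i)) ->
  mu.-integrable setT (EFin \o (fun x => \sum_(i <- s) f i x)).
Proof.
move=> intf; rewrite (_ : _ \o _ = fun x => (\sum_(i <- s) (EFin \o f i) x)%E).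
  exact: integrable_sum.
by apply/funext => x /=; rewrite sumEFin.
Qed.

Lemma Rintegral_sum (I : Type) (s : seq I) (f : I -> T -> R) :
  (forall i, mu.-integrable setT (EFin \o f i)) ->
  \int[mu]_x (\sum_(i <- s) f i x) = \sum_(i <- s) \int[mu]_x f i x.
Proof.
move=> intf; elim: s => [|i s IH].
  rewrite big_nil; under eq_Rintegral do rewrite big_nil.
  by rewrite Rintegral_cst // mul0r.
under eq_Rintegral do rewrite big_cons.
by rewrite big_cons RintegralD ?IH //; exact: integrable_EFin_sum.
Qed.

Lemma dominated_convergence_Rintegral (f_ : nat -> T -> R) (f g : T -> R) :
  (forall n, measurable_fun setT (f_ n)) -> measurable_fun setT f ->
  (forall x, f_ ^~ x @ \oo --> f x) ->
  mu.-integrable setT (EFin \o g) -> (forall n x, `|f_ n x| <= g x) ->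
  mu.-integrable setT (EFin \o f) /\
  \int[mu]_x f_ n x @[n --> \oo] --> \int[mu]_x f x.
Proof.
move=> mf_ mf cvf intg fg.
have [] := @dominated_convergence _ _ _ mu setT measurableT (fun n => EFin \o f_ n)
  (EFin \o f) (EFin \o g).
- by move=> n; apply/measurable_EFinP.
- exact/measurable_EFinP.
- by apply: aeW => x _; apply: cvg_EFin; [exact: nearW|exact: cvf].
- exact: intg.
- by apply: aeW => x n _; rewrite lee_fin.
move=> intf _ cvi; split => //.
by apply: fine_cvg; rewrite fineK // integrable_fin_num.
Qed.

End real_integral.

(** * Counts and functions of polynomial growth *)

Section counts.
Context d (E : measurableType d) (R : realType).
Local Notation N := (nmeasure E R).
Implicit Types (B : set E) (eta : N).

Definition count_in B eta : R := fine (eta B).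

Lemma measurable_nmeasure_ev B : measurable B ->
  measurable_fun setT (fun eta : N => eta B).
Proof.
move=> mB.
apply: (@measurability nmeasure_display _ N _ setT (fun eta : N => eta B) measurable).
  by rewrite smallest_id //; exact: sigma_algebra_measurable.
apply: subset_trans; last exact: sub_gen_smallest.
exact: (bigcup_sup mB).
Qed.

Lemma measurable_count_in B : measurable B -> measurable_fun setT (count_in B).
Proof.
move=> mB.
exact: (measurableT_comp (fine_measurable measurableT) (measurable_nmeasure_ev mB)).
Qed.

Lemma count_in_nat B eta : measurable B -> exists k : nat, count_in B eta = k%:R.
Proof.
by move=> mB; have [k e] := nmeasure_nat eta mB; exists k; rewrite /count_in e.
Qed.

Lemma count_inK B eta : measurable B -> eta B = (count_in B eta)%:E.
Proof. by move=> mB; rewrite fineK // fin_num_measure. Qed.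

Lemma count_in_ge0 B eta : 0 <= count_in B eta.
Proof. by rewrite fine_ge0. Qed.

Lemma le_count_in A B eta : measurable A -> measurable B -> A `<=` B ->
  count_in A eta <= count_in B eta.
Proof.
by move=> mA mB AB; rewrite -lee_fin -!count_inK // le_measure // inE.
Qed.

Lemma count_in_cover n (C : 'I_n -> set E) A eta :
  (forall i, measurable (C i)) -> trivIset setT C -> \bigcup_i C i = setT ->
  measurable A -> count_in A eta = \sum_(i < n) count_in (C i `&` A) eta.
Proof.
move=> mC tC cC mA; apply: EFin_inj; rewrite -count_inK // -sumEFin.
have mCA i : measurable (C i `&` A) by exact: measurableI.
under eq_bigr => i _ do rewrite -count_inK //.
rewrite -(@measure_bigsetU_ord _ _ _ eta n xpredT (fun i => C i `&` A)) //; last first.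
  exact: trivIset_setIr.
congr (eta _); rewrite -bigcup_seq -setI_bigcupl.
rewrite (_ : \bigcup_(i in _) _ = setT) ?setTI // -cC.
by apply: eq_bigcupl; split => i //= _; rewrite mem_index_enum.
Qed.

(** A class closed under sums and products that lies in L^2 of the Pascal law, since all moments of
    the total count are finite; it settles the integrability of the integrands below. Adding [1]
    makes the powers increase with [D]. *)
Definition poly_growth (g : N -> R) : Prop :=
  measurable_fun setT g /\
  exists C D, forall eta, `|g eta| <= C * (1 + count_in setT eta) ^+ D.

Let one_le eta : 1 <= 1 + count_in setT eta.
Proof. by rewrite lerDl count_in_ge0. Qed.

Lemma poly_growth_cst c : poly_growth (cst c).
Proof. by split => //; exists `|c|, 0%N => eta; rewrite expr0 mulr1. Qed.

Lemma poly_growth_count B : measurable B -> poly_growth (count_in B).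
Proof.
move=> mB; split; first exact: measurable_count_in.
exists 1, 1%N => eta; rewrite expr1 mul1r ger0_norm ?count_in_ge0 //.
apply: le_trans (_ : count_in setT eta <= _); last by rewrite lerDr.
exact: le_count_in.
Qed.

Lemma poly_growthM f g : poly_growth f -> poly_growth g ->
  poly_growth (fun eta => f eta * g eta).
Proof.
move=> [mf [C [D fC]]] [mg [C' [D' gC]]]; split; first exact: measurable_funM.
by exists (C * C'), (D + D')%N => eta; rewrite normrM exprD mulrACA ler_pM.
Qed.

Lemma poly_growthD f g : poly_growth f -> poly_growth g ->
  poly_growth (fun eta => f eta + g eta).
Proof.
move=> [mf [C [D fC]]] [mg [C' [D' gC]]]; split; first exact: measurable_funD.
exists (`|C| + `|C'|), (D + D')%N => eta; rewrite mulrDl.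
have l (c : R) k l : (k <= l)%N ->
    c * (1 + count_in setT eta) ^+ k <= `|c| * (1 + count_in setT eta) ^+ l.
  move=> kl; apply: le_trans (_ : `|c| * (1 + count_in setT eta) ^+ k <= _).
    by rewrite ler_wpM2r ?exprn_ge0 ?(le_trans ler01) ?ler_norm.
  by rewrite ler_wpM2l // ler_weXn2l.
apply: le_trans (ler_normD _ _) _; apply: lerD.
  by apply: le_trans (fC eta) _; exact/l/leq_addr.
by apply: le_trans (gC eta) _; exact/l/leq_addl.
Qed.

Lemma poly_growth_sum (I : Type) (s : seq I) (f : I -> N -> R) :
  (forall i, poly_growth (f i)) -> poly_growth (fun eta => \sum_(i <- s) f i eta).
Proof.
move=> pf; elim: s => [|i s IH].
  by under eq_fun do rewrite big_nil; exact: poly_growth_cst.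
by under eq_fun do rewrite big_cons; exact: poly_growthD.
Qed.

Lemma poly_growth_prod (I : Type) (s : seq I) (f : I -> N -> R) :
  (forall i, poly_growth (f i)) -> poly_growth (fun eta => \prod_(i <- s) f i eta).
Proof.
move=> pf; elim: s => [|i s IH].
  by under eq_fun do rewrite big_nil; exact: poly_growth_cst.
by under eq_fun do rewrite big_cons; exact: poly_growthM.
Qed.

Lemma poly_growthX f n : poly_growth f -> poly_growth (fun eta => f eta ^+ n).
Proof.
move=> pf; elim: n => [|n IH].
  by under eq_fun do rewrite expr0; exact: poly_growth_cst.
by under eq_fun do rewrite exprS; exact: poly_growthM.
Qed.

Lemma poly_growth_meixner n B a p : measurable B ->
  poly_growth (fun eta => meixner n (count_in B eta) a p).
Proof.
move=> mB; apply: poly_growth_sum => k; apply: poly_growthM.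
  exact: poly_growth_cst.
apply: poly_growth_prod => i; apply: poly_growthD; first exact: poly_growth_count.
exact: poly_growth_cst.
Qed.

End counts.

(** * Expectations under the Pascal law *)

Section pascal_law.
Context d (E : measurableType d) (R : realType).
Local Notation N := (nmeasure E R).
Variables (alpha : {finite_measure set E -> \bar R}) (p : R) (rho : probability N R).
Hypotheses (p0 : 0 < p) (p1 : p < 1) (hrho : pascal_distribution alpha p rho).
Implicit Types (B : set E) (eta : N).

Let pmf B k : R := pascal_pmf (fine (alpha B)) p k.
Let level B k : set N := [set eta | eta B = k%:R%:E].

Let measurable_level B k : measurable B -> measurable (level B k).
Proof.
move=> mB; rewrite -[level B k]setTI.
exact: (measurable_nmeasure_ev mB measurableT (emeasurable_set1 k%:R%:E)).
Qed.

Lemma pascal_joint_law n (C : 'I_n -> set E) (k : 'I_n -> nat) :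
  (forall i, measurable (C i)) -> trivIset setT C ->
  rho (\bigcap_i [set eta | eta (C i) = (k i)%:R%:E]) =
  (\prod_i pascal_pmf (fine (alpha (C i))) p (k i))%:E.
Proof.
move=> mC tC; case: hrho => d' [Om [P [zeta [[ind law] rhoE]]]].
have mcap : measurable (\bigcap_i level (C i) (k i)).
  by apply: fin_bigcap_measurable => // i _; exact: measurable_level.
rewrite rhoE // /distribution /pushforward preimage_bigcap.
have := ind n C mC tC (fun i => [set (k i)%:R%:E]) (fun=> emeasurable_set1 _).
move=> ->; rewrite -prodEFin; apply: eq_bigr => i _.
by rewrite -law.
Qed.

(** The function [f] of the count, cut off at [m]. As a finite combination of level-set indicators
    it has a finite sum as expectation. *)
Let trunc (f : R -> R) B m eta : R := \sum_(k < m) f k%:R * \1_(level B k) eta.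

Let truncE f B m eta : measurable B ->
  trunc f B m eta = if count_in B eta < m%:R then f (count_in B eta) else 0.
Proof.
move=> mB; have [j ej] := nmeasure_nat eta mB.
have cj : count_in B eta = j%:R by rewrite /count_in ej.
have lv k : \1_(level B k) eta = (k == j)%:R :> R.
  rewrite indicE; congr (_%:R); congr nat_of_bool; apply/idP/idP.
    by rewrite inE /level /= ej => -[] /eqP; rewrite eqr_nat eq_sym.
  by move=> /eqP ->; rewrite inE.
rewrite cj ltr_nat /trunc; under eq_bigr do rewrite lv.
case: ltnP => [jm|mj].
  rewrite (bigD1 (Ordinal jm)) //= eqxx mulr1 big1 ?addr0 // => i.
  by rewrite -val_eqE /= => /negbTE ->; rewrite mulr0.
by rewrite big1 // => i _; rewrite ltn_eqF ?mulr0 // (leq_trans _ mj).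
Qed.

Let measurable_trunc f B m : measurable B -> measurable_fun setT (trunc f B m).
Proof.
move=> mB; apply: measurable_sum => k; apply: measurable_funM => //.
by apply: measurable_indic; exact: measurable_level.
Qed.

(** The product of sums expands over all choices [h] of one level per set. Each term is the
    indicator of a joint level set, whose probability factorizes by [pascal_joint_law]. *)
Let trunc_integral n (C : 'I_n -> set E) (f : 'I_n -> R -> R) m :
  (forall i, measurable (C i)) -> trivIset setT C ->
  rho.-integrable setT (EFin \o (fun eta => \prod_i trunc (f i) (C i) m eta)) /\
  \int[rho]_eta (\prod_i trunc (f i) (C i) m eta) =
  \prod_i \sum_(k < m) f i k%:R * pmf (C i) k.
Proof.
move=> mC tC.
pose cap (h : {ffun 'I_n -> 'I_m}) := \bigcap_i level (C i) (h i).
have mcap h : measurable (cap h).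
  by apply: fin_bigcap_measurable => // i _; exact: measurable_level.
have -> : (fun eta => \prod_i trunc (f i) (C i) m eta) =
  (fun eta => \sum_(h : {ffun 'I_n -> 'I_m}) (\prod_i f i (h i)%:R) * \1_(cap h) eta).
  apply/funext => eta; rewrite /trunc bigA_distr_bigA; apply: eq_bigr => h _.
  rewrite big_split /=; congr (_ * _); rewrite indicE.
  have [/set_mem capeta|] := boolP (eta \in cap h).
    by rewrite big1 // => i _; rewrite indicE mem_set //; exact: capeta.
  move=> /negP ncap; have [i ni] : exists i, ~ level (C i) (h i) eta.
    apply/existsNP => H; apply: ncap; apply/mem_set => i _; exact: H.
  by rewrite (bigD1 i) //= indicE memNset // mul0r.
have intc (h : {ffun 'I_n -> 'I_m}) : rho.-integrable setT
    (EFin \o (fun eta => (\prod_i f i (h i)%:R) * \1_(cap h) eta)).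
  have := integrable_indic rho (mcap h).
  by move/(integrableZl measurableT (\prod_i f i (h i)%:R)).
split; first exact: integrable_EFin_sum.
rewrite Rintegral_sum // bigA_distr_bigA; apply: eq_bigr => h _.
rewrite RintegralZl //; last exact: integrable_indic.
rewrite big_split /=; congr (_ * _).
rewrite /Rintegral integral_indic // setIT.
by have /(congr1 fine) := pascal_joint_law (fun i => h i) mC tC.
Qed.

Let trunc_integral1 B (f : R -> R) m : measurable B ->
  rho.-integrable setT (EFin \o trunc f B m) /\
  \int[rho]_eta trunc f B m eta = \sum_(k < m) f k%:R * pmf B k.
Proof.
move=> mB; have [] := @trunc_integral 1 (fun=> B) (fun=> f) m.
- by [].
- by move=> i j _ _ _; rewrite !ord1.
by under eq_fun do rewrite big_ord1; rewrite big_ord1.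
Qed.

(** The partial sum is the expectation of the constant [1] cut off at [m]. *)
Lemma pascal_mass_le1 B m : measurable B ->
  \sum_(k < m) pascal_pmf (fine (alpha B)) p k <= 1.
Proof.
move=> mB; have [int1 e1] := @trunc_integral1 B (fun=> 1) m mB.
have <- : \int[rho]_eta trunc (fun=> 1) B m eta = \sum_(k < m) pmf B k.
  by rewrite e1; apply: eq_bigr => k _; rewrite mul1r.
apply: le_trans (_ : \int[rho]_eta cst 1 eta <= _).
  apply: le_Rintegral => //.
    exact: finite_measure_integrable_cst.
  by move=> eta _; rewrite truncE //=; case: ifP.
rewrite Rintegral_cst // mul1r.
by have /(congr1 fine) -> := probability_setT rho.
Qed.

Let alpha_ge0 B : 0 <= fine (alpha B).
Proof. exact: fine_ge0. Qed.

Let cvg_pmf_moment B i : measurable B ->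
  cvgn (fun m => \sum_(k < m) k%:R ^+ i * pmf B k).
Proof. by move=> mB; apply: cvg_pascal_moment => // m; exact: pascal_mass_le1. Qed.

Let cvg_trunc f B eta : measurable B ->
  trunc f B m eta @[m --> \oo] --> f (count_in B eta).
Proof.
move=> mB; have [j ej] := count_in_nat eta mB.
apply: cvg_near_cst; exists j.+1 => // m /= jm; rewrite truncE //.
by rewrite ifT // ej ltr_nat.
Qed.

(** The free power [i] lets the induction on [D] absorb the second summand of a factor [1 + k]. *)
Let cvg_pmf_moment_shift D B i : measurable B ->
  cvgn (fun m => \sum_(k < m) k%:R ^+ i * (1 + k%:R) ^+ D * pmf B k).
Proof.
move=> mB; elim: D i => [|D IH] i.
  under eq_fun do under eq_bigr do rewrite expr0 mulr1.
  exact: cvg_pmf_moment.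
have -> : (fun m => \sum_(k < m) k%:R ^+ i * (1 + k%:R) ^+ D.+1 * pmf B k) =
  (fun m => \sum_(k < m) k%:R ^+ i * (1 + k%:R) ^+ D * pmf B k) +
  (fun m => \sum_(k < m) k%:R ^+ i.+1 * (1 + k%:R) ^+ D * pmf B k).
  apply/funext => m; rewrite fctE -big_split /=; apply: eq_bigr => k _.
  by rewrite !exprS; ring.
exact: is_cvgD.
Qed.

(** Monotone convergence along the truncations, whose integrals are partial sums of a convergent
    series of moments. *)
Lemma integrable_pascal_moment D :
  rho.-integrable setT (EFin \o (fun eta => (1 + count_in setT eta) ^+ D)).
Proof.
pose f (x : R) := (1 + x) ^+ D.
have mf : measurable_fun setT (fun eta : N => (1 + count_in setT eta) ^+ D).
  by apply: measurable_funX; apply: measurable_funD => //; exact: measurable_count_in.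
have f0 eta : 0 <= f (count_in setT eta).
  by rewrite exprn_ge0 // addr_ge0 // count_in_ge0.
have [M bM] : exists M, forall m, \sum_(k < m) f k%:R * pmf setT k <= M.
  have [M [_ bM]] := cvg_seq_bounded (@cvg_pmf_moment_shift D setT 0 measurableT).
  exists (M + 1) => m; have := bM (M + 1) _ m I.
  rewrite ltrDl => /(_ ltr01) /= /ler_normlW.
  by under eq_bigr do rewrite expr0 mul1r.
apply/integrableP; split; first exact/measurable_EFinP.
under eq_integral => eta _ do rewrite /= ger0_norm -/(f _) //.
apply: (@le_lt_trans _ _ M%:E); last exact: ltry.
have cv : (\int[rho]_eta (trunc f setT m eta)%:E)%E @[m --> \oo] -->
    (\int[rho]_eta (f (count_in setT eta))%:E)%E.
  have -> : (\int[rho]_eta (f (count_in setT eta))%:E =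
      \int[rho]_eta limn (fun m => (trunc f setT m eta)%:E))%E.
    apply: eq_integral => eta _; apply/esym/cvg_lim => //.
    by apply: cvg_EFin; [exact: nearW|exact: cvg_trunc].
  apply: cvg_monotone_convergence => //.
  - by move=> m; apply/measurable_EFinP; exact: measurable_trunc.
  - by move=> m eta _; rewrite lee_fin truncE //; case: ifP.
  - move=> eta _ m m' mm'; rewrite lee_fin !truncE //.
    case: ltP => [lm|_]; last by case: ifP.
    by rewrite ifT // (lt_le_trans lm) // ler_nat.
rewrite -(cvg_lim _ cv) //.
apply: lime_le; first by apply/cvg_ex; eexists; exact: cv.
apply: nearW => m; have [im em] := trunc_integral1 f m measurableT.
by rewrite -[leLHS]fineK ?integrable_fin_num // lee_fin -/(Rintegral _ _ _) em.
Qed.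

Lemma poly_growth_integrable g : poly_growth g -> rho.-integrable setT (EFin \o g).
Proof.
move=> [mg [C [D gC]]].
have intC := integrableZl measurableT C (integrable_pascal_moment D).
apply: le_integrable intC => //; first exact/measurable_EFinP.
by move=> eta _; rewrite lee_fin (le_trans (gC eta)) // ler_norm.
Qed.

Lemma poly_growth_Lfun2 g : poly_growth g -> g \in Lfun rho 2%:E.
Proof.
move=> pg; rewrite inE; apply/andP; split; rewrite inE /=; first by case: pg.
have /poly_growth_integrable/integrableP[_] := poly_growthM pg pg.
rewrite /finite_norm unlock => fin; apply: poweR_lty; apply: le_lt_trans fin.
rewrite le_eqVlt; apply/orP; left; apply/eqP; apply: eq_integral => eta _ /=.
rewrite normrM -expr2 -powR_mulrn //.
Qed.

(** The factorization is exact for truncated factors; dominated convergence, with the product of the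
    absolute values as majorant, removes the truncation. *)
Lemma cvg_pascal_prod_expectation n (C : 'I_n -> set E) (f : 'I_n -> R -> R) :
  (forall i, measurable (C i)) -> trivIset setT C ->
  (forall i, poly_growth (fun eta => f i (count_in (C i) eta))) ->
  \prod_i \sum_(k < m) f i k%:R * pascal_pmf (fine (alpha (C i))) p k @[m --> \oo] -->
  \int[rho]_eta \prod_i f i (count_in (C i) eta).
Proof.
move=> mC tC pf.
have pg : poly_growth (fun eta => \prod_i f i (count_in (C i) eta)).
  exact: poly_growth_prod.
under eq_cvg do rewrite -(trunc_integral _ _ mC tC).2.
have pn : poly_growth (fun eta => \prod_i `|f i (count_in (C i) eta)|).
  apply: poly_growth_prod => i; have [mf [K [D fK]]] := pf i.
  split; first exact: measurableT_comp.
  by exists K, D => eta; rewrite normr_id.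
apply: (dominated_convergence_Rintegral _ _ _ (poly_growth_integrable pn) _).2.
- by move=> m; apply: measurable_prod => i _; exact: measurable_trunc.
- by case: pg.
- move=> eta; apply: cvg_big => [|i _]; first exact: mul_continuous.
  exact: cvg_trunc.
- move=> m eta; rewrite normr_prod; apply: ler_prod => i _; rewrite normr_ge0 /=.
  by rewrite truncE //; case: ifP => // _; rewrite normr0.
Qed.

Lemma pascal_meixner_moment_eq0 n (C : 'I_n -> set E) (e m : 'I_n -> nat) :
  (forall i, measurable (C i)) -> trivIset setT C ->
  (\sum_i m i < \sum_i e i)%N ->
  \int[rho]_eta (\prod_i (meixner (e i) (count_in (C i) eta) (fine (alpha (C i))) p *
    count_in (C i) eta ^+ m i)) = 0.
Proof.
move=> mC tC lt_me.
have [j lt_j] : exists j, (m j < e j)%N.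
  apply/existsP; apply: contraLR lt_me => /existsPn H; rewrite -leqNgt.
  by apply: leq_sum => i _; rewrite leqNgt H.
pose f i x := meixner (e i) x (fine (alpha (C i))) p * x ^+ m i.
have pf i : poly_growth (fun eta => f i (count_in (C i) eta)).
  apply: poly_growthM; first exact: poly_growth_meixner.
  by apply: poly_growthX; exact: poly_growth_count.
have cv := cvg_pascal_prod_expectation mC tC pf.
suff cv0 : \prod_i \sum_(k < l) f i k%:R * pascal_pmf (fine (alpha (C i))) p k
    @[l --> \oo] --> 0 by exact: (cvg_unique _ cv cv0).
under eq_cvg do rewrite (bigD1 j) //=.
have cvj : \sum_(k < l) f j k%:R * pascal_pmf (fine (alpha (C j))) p k @[l --> \oo] --> 0.
  by apply: meixner_orthogonal => // k; exact: pascal_mass_le1.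
(* The factor at [j] tends to zero, so the others only have to converge; this is the case of the
   single set [C i]. *)
have cvi : \prod_(i | i != j) \sum_(k < l) f i k%:R * pascal_pmf (fine (alpha (C i))) p k
    @[l --> \oo] --> \prod_(i | i != j) \int[rho]_eta f i (count_in (C i) eta).
  apply: cvg_big => [|i _]; first exact: mul_continuous.
  have := @cvg_pascal_prod_expectation 1 (fun=> C i) (fun=> f i).
  under eq_cvg do rewrite big_ord1; under eq_Rintegral do rewrite big_ord1.
  by apply => // i1 j1 _ _ _; rewrite !ord1.
by have := cvgM cvj cvi; rewrite mul0r; exact.
Qed.

End pascal_law.

(** * Splitting one cell of a partition *)

Section split_family.
Context (T : Type) (n : nat) (j : 'I_n).

(** The value at [j] is replaced by [uj], and the second piece [u0] is placed in front at [ord0].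
    The same operation serves for the cells and for both families of exponents. *)
Definition split_family (u0 uj : T) (u : 'I_n -> T) (i : 'I_n.+1) : T :=
  if unlift ord0 i is Some i' then if i' == j then uj else u i' else u0.

Variables (u0 uj : T) (u : 'I_n -> T).

Lemma split_family0 : split_family u0 uj u ord0 = u0.
Proof. by rewrite /split_family unlift_none. Qed.

Lemma split_family_lift : split_family u0 uj u (lift ord0 j) = uj.
Proof. by rewrite /split_family liftK eqxx. Qed.

Lemma split_family_neq i : i != j -> split_family u0 uj u (lift ord0 i) = u i.
Proof. by move=> /negbTE ij; rewrite /split_family liftK ij. Qed.

End split_family.

Section split_sets.
Context d (E : measurableType d) (n : nat) (C : 'I_n -> set E) (j : 'I_n) (A : set E).
Let C' := split_family j (C j `\` A) (C j `&` A) C.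

Lemma measurable_split_sets : measurable A -> (forall i, measurable (C i)) ->
  forall i, measurable (C' i).
Proof.
move=> mA mC i; rewrite /C' /split_family; case: unliftP => [i' _|_].
  by case: ifP => _ //; exact: measurableI.
exact: measurableD.
Qed.

Lemma trivIset_split_sets : trivIset setT C -> trivIset setT C'.
Proof.
move=> tC i1 i2 _ _; rewrite /C' /split_family.
case: unliftP => [a ->|->]; case: unliftP => [b ->|->] // [x []].
- have tri u v : C u x -> C v x -> u = v by move=> Cu Cv; apply: tC => //; exists x.
  case: ifP => [/eqP ->|_]; case: ifP => [/eqP ->|_] //.
  + by move=> [Cj _] Cb; rewrite (tri _ _ Cj Cb).
  + by move=> Ca [Cj _]; rewrite (tri _ _ Cj Ca).
  + by move=> Ca Cb; rewrite (tri _ _ Ca Cb).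
- case: ifP => [/eqP ->|/eqP aj]; first by move=> [_ ?] [].
  by move=> Ca [Cj _]; exfalso; apply: aj; apply: tC => //; exists x.
- case: ifP => [/eqP ->|/eqP aj]; first by move=> [_ ?] [].
  by move=> [Cj _] Ca; exfalso; apply: aj; apply: tC => //; exists x.
Qed.

Lemma cover_split_sets : \bigcup_i C i = setT -> \bigcup_i C' i = setT.
Proof.
move=> cC; rewrite -subTset => x _; have : (\bigcup_i C i) x by rewrite cC.
move=> [i _ Ci]; have [ij|ij] := eqVneq i j; last first.
  by exists (lift ord0 i) => //; rewrite /C' split_family_neq.
have [Ax|nAx] := pselect (A x).
  by exists (lift ord0 j) => //; rewrite /C' split_family_lift; split; rewrite -?ij.
by exists ord0 => //; rewrite /C' split_family0; split; rewrite -?ij.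
Qed.

End split_sets.

(** * Orthogonality to products of counts *)

Section set_products.
Context d (E : measurableType d) (R : realType).
Local Notation N := (nmeasure E R).
Variables (alpha : {finite_measure set E -> \bar R}) (p : R) (rho : probability N R).
Hypotheses (p0 : 0 < p) (p1 : p < 1) (hrho : pascal_distribution alpha p rho).
Implicit Types (B : set E) (eta : N).

Let a B : R := fine (alpha B).
Let cell B (e m : nat) eta := meixner e (count_in B eta) (a B) p * count_in B eta ^+ m.

Let poly_growth_cell B e m : measurable B -> poly_growth (cell B e m).
Proof.
move=> mB; apply: poly_growthM; first exact: poly_growth_meixner.
by apply: poly_growthX; exact: poly_growth_count.
Qed.

Let count_in_split B A eta : measurable B -> measurable A ->
  count_in B eta = count_in (B `&` A) eta + count_in (B `\` A) eta.
Proof.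
move=> mB mA; apply: EFin_inj; rewrite EFinD -!count_inK //; last 2 first.
- exact: measurableD.
- exact: measurableI.
by rewrite addeC -measureDI.
Qed.

Let alpha_split B A : measurable B -> measurable A -> a B = a (B `&` A) + a (B `\` A).
Proof.
move=> mB mA; apply: EFin_inj; rewrite EFinD !fineK ?fin_num_measure //; last 2 first.
- exact: measurableD.
- exact: measurableI.
by rewrite addeC -measureDI.
Qed.

(** The addition formula expands the Meixner factor and the binomial theorem the power. The extra
    count raises the power on the inner piece, whence the successor. *)
Let cell_split B A e m eta : measurable B -> measurable A ->
  cell B e m eta * count_in (B `&` A) eta =
  \sum_(x < e.+1) \sum_(y < m.+1) ('C(e, x)%:R * 'C(m, y)%:R) *
    (cell (B `\` A) (e - x) y eta * cell (B `&` A) x (m - y).+1 eta).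
Proof.
move=> mB mA; rewrite {1}/cell (count_in_split _ mB mA) (alpha_split mB mA).
have [k1 e1] := count_in_nat eta (measurableI _ _ mB mA).
have [k2 e2] := count_in_nat eta (measurableD mB mA).
rewrite e1 e2 -natrD meixnerD natrD exprDn -mulrA /binconv.
rewrite [X in _ * X]mulr_suml [LHS]mulr_suml.
apply: eq_bigr => x _; rewrite mulr_sumr; apply: eq_bigr => y _.
by rewrite /cell e1 e2 exprSr -mulr_natr; ring.
Qed.

(** The induction on [k] runs over all partitions and exponents, because removing [A k] refines the
    partition. *)
Lemma pascal_meixner_set_product_eq0 k (A : nat -> set E) :
  (forall i, measurable (A i)) ->
  forall n (C : 'I_n -> set E) (e m : 'I_n -> nat),
  (forall i, measurable (C i)) -> trivIset setT C -> \bigcup_i C i = setT ->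
  (\sum_i m i + k < \sum_i e i)%N ->
  \int[rho]_eta ((\prod_i (meixner (e i) (count_in (C i) eta) (fine (alpha (C i))) p *
    count_in (C i) eta ^+ m i)) * \prod_(i < k) count_in (A i) eta) = 0.
Proof.
move=> mA; elim: k => [|k IH] n C e m mC tC cC.
  rewrite addn0 => lt_me; under eq_Rintegral do rewrite big_ord0 mulr1.
  exact: (pascal_meixner_moment_eq0 p0 p1 hrho).
move=> lt_me.
have E1 eta : (\prod_i cell (C i) (e i) (m i) eta) * \prod_(i < k.+1) count_in (A i) eta =
    \sum_j \sum_(x < (e j).+1) \sum_(y < (m j).+1) ('C(e j, x)%:R * 'C(m j, y)%:R) *
    ((\prod_i cell (split_family j (C j `\` A k) (C j `&` A k) C i)
      (split_family j (e j - x)%N (nat_of_ord x) e i)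
      (split_family j (nat_of_ord y) (m j - y).+1 m i) eta) *
      \prod_(i < k) count_in (A i) eta).
  rewrite big_ord_recr /= (count_in_cover eta mC tC cC (mA k)) !mulr_sumr.
  apply: eq_bigr => j _.
  rewrite (bigD1 j) //=.
  transitivity (cell (C j) (e j) (m j) eta * count_in (C j `&` A k) eta *
    ((\prod_(i < n | i != j) cell (C i) (e i) (m i) eta) *
      \prod_(i < k) count_in (A i) eta)).
    by ring.
  rewrite cell_split // mulr_suml; apply: eq_bigr => x _.
  rewrite mulr_suml; apply: eq_bigr => y _.
  rewrite [in RHS]big_ord_recl !split_family0 [in RHS](bigD1 j) //= !split_family_lift.
  rewrite [in RHS](eq_bigr (fun i => cell (C i) (e i) (m i) eta)); last first.
    by move=> i ij; rewrite !split_family_neq.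
  ring.
apply: etrans (congr1 (Rintegral rho setT) (funext E1)) _.
have pA : poly_growth (fun eta : N => \prod_(i < k) count_in (A i) eta).
  by apply: poly_growth_prod => i; exact: poly_growth_count.
have pT j x y : poly_growth (fun eta => \prod_i cell
      (split_family j (C j `\` A k) (C j `&` A k) C i)
      (split_family j (e j - x)%N x e i)
      (split_family j y (m j - y).+1 m i) eta).
  apply: poly_growth_prod => i; apply: poly_growth_cell.
  exact: measurable_split_sets.
rewrite Rintegral_sum; last first.
  move=> j; apply: (poly_growth_integrable p0 p1 hrho).
  apply: poly_growth_sum => x; apply: poly_growth_sum => y.
  by apply: poly_growthM; [exact: poly_growth_cst|exact: poly_growthM].
rewrite big1 // => j _; rewrite Rintegral_sum; last first.
  move=> x; apply: (poly_growth_integrable p0 p1 hrho); apply: poly_growth_sum => ?.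
  by apply: poly_growthM; [exact: poly_growth_cst|exact: poly_growthM].
rewrite big1 // => x _; rewrite Rintegral_sum; last first.
  move=> y; apply: (poly_growth_integrable p0 p1 hrho).
  by apply: poly_growthM; [exact: poly_growth_cst|exact: poly_growthM].
rewrite big1 // => y _; rewrite RintegralZl //; last first.
  by apply: (poly_growth_integrable p0 p1 hrho); exact: poly_growthM.
rewrite IH ?mulr0 //.
- exact: measurable_split_sets.
- exact: trivIset_split_sets.
- exact: cover_split_sets.
have Es (u0 uj : nat) u :
    (\sum_i split_family j u0 uj u i = u0 + (uj + \sum_(i | i != j) u i))%N.
  rewrite big_ord_recl split_family0 (bigD1 j) //= split_family_lift.
  by congr (_ + (_ + _))%N; apply: eq_bigr => i ij; rewrite split_family_neq.
(* Here [x <= e j] and [y <= m j], so the subtractions are exact: the total of the [e] is unchanged,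
   while that of the [m] grows by one and makes up for the removed count. *)
rewrite !Es; move: lt_me; rewrite (bigD1 j) //= [in X in (_ < X)%N](bigD1 j) //=.
have := ltn_ord x; have := ltn_ord y; lia.
Qed.

End set_products.

(** * Rectangles in the powers of the space *)

Section rectangles.
Context d (E : measurableType d) (R : realType).
Implicit Types (A : nat -> set E) (k : nat).

(** Only the first [k] sets are read; indexing by [nat] allows families to be shifted and
    concatenated. *)
Definition rectangle k A : set (k.-tuple E) := [set x | forall i : 'I_k, A i (tnth x i)].
Arguments rectangle k A : clear implicits.

Lemma measurable_rectangle k A : (forall i, measurable (A i)) ->
  measurable (rectangle k A).
Proof.
move=> mA; have -> : rectangle k A = \bigcap_(i : 'I_k) ((fun x => tnth x i) @^-1` A i).
  by apply/seteqP; split => x /= H i; [move=> _; exact: H|exact: H].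
apply: fin_bigcap_measurable => // i _; rewrite -[X in measurable X]setTI.
exact: measurable_tnth.
Qed.

(** Preimages under a coordinate are rectangles with [setT] in the other places. Rectangles are the
    intersection-stable generator for the Dynkin argument below. *)
Lemma tuple_measurableE k :
  @measurable _ (k.-tuple E) =
  <<s [set rectangle k A | A in [set A | forall i, measurable (A i)]] >>.
Proof.
apply/seteqP; split; last first.
  apply: smallest_sub; first exact: sigma_algebra_measurable.
  by move=> _ [A mA <-]; exact: measurable_rectangle.
apply: smallest_sub; first exact: smallest_sigma_algebra.
move=> X; rewrite -bigcup_seq => -[i _ [A mA <-]].
apply: sub_sigma_algebra; exists (fun l => if l == i :> nat then A else setT).
  by move=> l /=; case: ifP.
apply/seteqP; split => x /=; first by move=> /(_ i); rewrite eqxx.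
by move=> [_ Ax] l; case: eqP => // /val_inj ->.
Qed.

Lemma setI_closed_rectangle k :
  setI_closed [set rectangle k A | A in [set A | forall i, measurable (A i)]].
Proof.
move=> _ _ [A mA <-] [B mB <-]; exists (fun i => A i `&` B i).
  by move=> i; exact: measurableI.
apply/seteqP; split => x /=; first by move=> H; split => i; have [] := H i.
by move=> [HA HB] i; split; [exact: HA|exact: HB].
Qed.

(** Pulled back along [cons_pair], the rectangle is the product of [A 0] and the rectangle of the
    shifted family. *)
Lemma mpower_rectangle (mu : {finite_measure set E -> \bar R}) k A :
  (forall i, measurable (A i)) ->
  mpower mu k (rectangle k A) = (\prod_(i < k) mu (A i))%E.
Proof.
elim: k A => [|k IH] A mA.
  rewrite big_ord0 /= diracE mem_set // => -[].
  by [].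
rewrite big_ord_recl -(IH (fun i => A i.+1)) //.
rewrite -product_measure1E //; last exact: measurable_rectangle.
rewrite /= /cons_measure /pushforward; congr ((_ \x _)%E _).
apply/seteqP; split => -[x t] /=.
  move=> H; split => [|i]; first by have := H ord0; rewrite tnth0.
  by have := H (lift ord0 i); rewrite tnthS.
move=> [Ax At] i; case: (unliftP ord0 i) => [j ->|->]; last by rewrite tnth0.
by rewrite tnthS; exact: At.
Qed.

End rectangles.
Arguments rectangle {d E} k A.

(** * Integrals against powers of a counting measure *)

Section power_integral_theory.
Context d (E : measurableType d) (R : realType).
Local Notation N := (nmeasure E R).
Implicit Types (eta : N) (k : nat).

Lemma mpower_setT k eta : mpower eta k setT = (count_in setT eta ^+ k)%:E.
Proof.
have -> : [set: k.-tuple E] = rectangle k (fun=> setT) by apply/seteqP; split.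
apply: etrans (mpower_rectangle eta k (fun=> measurableT)) _.
under eq_bigr do rewrite count_inK //.
by rewrite prodEFin prodr_const card_ord.
Qed.

Lemma power_integral_rectangle k (A : nat -> set E) eta : (forall i, measurable (A i)) ->
  power_integral (\1_(rectangle k A)) eta = \prod_(i < k) count_in (A i) eta.
Proof.
move=> mA; have mr := @measurable_rectangle _ E k A mA.
rewrite /power_integral /Rintegral integral_indic //.
rewrite setIT; have /(congr1 fine) -> := mpower_rectangle eta k mA.
by under eq_bigr do rewrite count_inK //; rewrite prodEFin.
Qed.

Lemma bounded_measurable_integrable k (f : k.-tuple E -> R) eta :
  bounded_measurable f -> (mpower eta k).-integrable setT (EFin \o f).
Proof.
move=> [mf [C fC]].
apply: (@le_integrable _ _ _ _ _ measurableT _ (EFin \o cst C)).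
- exact/measurable_EFinP.
- by move=> x _; rewrite lee_fin (le_trans (fC x)) // ler_norm.
- exact: finite_measure_integrable_cst.
Qed.

Lemma bounded_measurableD k (f g : k.-tuple E -> R) :
  bounded_measurable f -> bounded_measurable g -> bounded_measurable (fun x => f x + g x).
Proof.
move=> [mf [C fC]] [mg [D gD]]; split; first exact: measurable_funD.
by exists (C + D) => x; rewrite (le_trans (ler_normD _ _)) // lerD.
Qed.

Lemma bounded_measurableZ k c (f : k.-tuple E -> R) :
  bounded_measurable f -> bounded_measurable (fun x => c * f x).
Proof.
move=> [mf [C fC]]; split; first exact: measurable_funM.
by exists (`|c| * C) => x; rewrite normrM ler_wpM2l.
Qed.

Lemma bounded_measurable_indic k (A : set (k.-tuple E)) :
  measurable A -> bounded_measurable (\1_A : _ -> R).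
Proof.
move=> mA; split; first exact: measurable_indic.
by exists 1 => x; rewrite indicE; case: (_ \in _); rewrite ?normr0 ?normr1.
Qed.

Lemma power_integralD k (f g : k.-tuple E -> R) eta :
  bounded_measurable f -> bounded_measurable g ->
  power_integral (fun x => f x + g x) eta = power_integral f eta + power_integral g eta.
Proof.
by move=> bf bg; apply: RintegralD => //; exact: bounded_measurable_integrable.
Qed.

Lemma power_integralZ k c (f : k.-tuple E -> R) eta :
  bounded_measurable f ->
  power_integral (fun x => c * f x) eta = c * power_integral f eta.
Proof. by move=> bf; apply: RintegralZl => //; exact: bounded_measurable_integrable. Qed.

Lemma power_integral_bound k (f : k.-tuple E -> R) C eta :
  measurable_fun setT f -> (forall x, `|f x| <= C) ->
  `|power_integral f eta| <= C * count_in setT eta ^+ k.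
Proof.
move=> mf fC; have bf : bounded_measurable f by split => //; exists C.
have intf := bounded_measurable_integrable eta bf.
apply: le_trans (le_normr_Rintegral measurableT intf) _.
have <- : \int[mpower eta k]_x cst C x = C * count_in setT eta ^+ k.
  by rewrite Rintegral_cst //; have /(congr1 fine) -> := mpower_setT k eta.
apply: le_Rintegral => //; last exact: finite_measure_integrable_cst.
by move/integrable_norm : intf.
Qed.

End power_integral_theory.

(** * The monotone class argument *)

Section monotone_class.
Context d (E : measurableType d) (R : realType).
Local Notation N := (nmeasure E R).
Variables (alpha : {finite_measure set E -> \bar R}) (p : R) (rho : probability N R).
Hypotheses (p0 : 0 < p) (p1 : p < 1) (hrho : pascal_distribution alpha p rho).
Variables (k : nat) (h : N -> R).
Hypothesis pg_h : poly_growth h.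
Hypothesis h_rect : forall A : nat -> set E, (forall i, measurable (A i)) ->
  \int[rho]_eta (h eta * \prod_(i < k) count_in (A i) eta) = 0.
Implicit Types (f g : k.-tuple E -> R).

(** Measurability of the power integral in [eta] is itself obtained by the monotone class argument,
    so it is carried along with the orthogonality. *)
Let good f := [/\ bounded_measurable f, poly_growth (power_integral f) &
  \int[rho]_eta (h eta * power_integral f eta) = 0].

Let integrable_pg (u : N -> R) : poly_growth u ->
  rho.-integrable setT (EFin \o (fun eta => h eta * u eta)).
Proof. by move=> pg; apply: (poly_growth_integrable p0 p1 hrho); exact: poly_growthM. Qed.

Let goodD f g : good f -> good g -> good (fun x => f x + g x).
Proof.
move=> [bf pf hf] [bg pg hg].
have E1 : power_integral (fun x => f x + g x) =
    fun eta => power_integral f eta + power_integral g eta.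
  by apply/funext => eta; exact: power_integralD.
split; first exact: bounded_measurableD.
  by rewrite E1; exact: poly_growthD.
rewrite E1; under eq_Rintegral do rewrite mulrDr.
by rewrite RintegralD // ?hf ?hg ?addr0 //; exact: integrable_pg.
Qed.

Let goodZ c f : good f -> good (fun x => c * f x).
Proof.
move=> [bf pf hf].
have E1 : power_integral (fun x => c * f x) = fun eta => c * power_integral f eta.
  by apply/funext => eta; exact: power_integralZ.
split; first exact: bounded_measurableZ.
  by rewrite E1; apply: poly_growthM => //; exact: poly_growth_cst.
rewrite E1; under eq_Rintegral do rewrite mulrCA.
by rewrite RintegralZl // ?hf ?mulr0 //; exact: integrable_pg.
Qed.

Let good_sum n (f : 'I_n -> k.-tuple E -> R) : (forall i, good (f i)) -> good (cst 0) ->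
  good (fun x => \sum_(i < n) f i x).
Proof.
elim: n f => [|n IH] f gf g0; first by under eq_fun do rewrite big_ord0.
have gl : good (fun x => \sum_(i < n) f (lift ord0 i) x).
  by apply: IH => // i; exact: gf.
suff -> : (fun x => \sum_(i < n.+1) f i x) =
    (fun x => f ord0 x + \sum_(i < n) f (lift ord0 i) x) by exact: goodD (gf _) gl.
by apply/funext => x; rewrite big_ord_recl.
Qed.

(** Dominated convergence is applied twice: under the power of [eta] with majorant [C], then under
    [rho] with majorant [|h|] times [C] times the [k]-th power of the total count. *)
Let good_lim (f_ : nat -> k.-tuple E -> R) f C :
  (forall n, good (f_ n)) -> (forall n x, `|f_ n x| <= C) ->
  (forall x, f_ ^~ x @ \oo --> f x) -> good f.
Proof.
move=> gf fC cvf.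
have mf : measurable_fun setT f.
  by apply: (measurable_fun_cvg (h := f_)) => // n; have [[]] := gf n.
have fle x : `|f x| <= C.
  have cvn : `|f_ n x| @[n --> \oo] --> `|f x| by apply: cvg_norm; exact: cvf.
  rewrite -(cvg_lim _ cvn) //; apply: limr_le; first by apply/cvg_ex; exists `|f x|.
  exact: nearW.
have cvp eta : power_integral (f_ n) eta @[n --> \oo] --> power_integral f eta.
  apply: (dominated_convergence_Rintegral _ mf cvf (g := cst C) _ _).2 => //.
    by move=> n; have [[]] := gf n.
  exact: finite_measure_integrable_cst.
have pgb : poly_growth (fun eta : N => C * count_in setT eta ^+ k).
  apply: poly_growthM; first exact: poly_growth_cst.
  by apply: poly_growthX; exact: poly_growth_count.
have pf : poly_growth (power_integral f).
  split.
    apply: (measurable_fun_cvg (h := fun n => power_integral (f_ n))) => // n.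
    by have [_ []] := gf n.
  have [_ [K [D bK]]] := pgb; exists K, D => eta.
  apply: le_trans (power_integral_bound eta mf fle) _.
  exact: le_trans (ler_norm _) (bK eta).
split => //; first by split => //; exists C.
have cvi : \int[rho]_eta (h eta * power_integral (f_ n) eta) @[n --> \oo] -->
    \int[rho]_eta (h eta * power_integral f eta).
  apply: (dominated_convergence_Rintegral _ _ _
    (g := fun eta => `|h eta| * (C * count_in setT eta ^+ k)) _ _).2.
  - by move=> n; have [_ [mp _] _] := gf n; apply: measurable_funM => //; case: pg_h.
  - by apply: measurable_funM; [case: pg_h|case: pf].
  - by move=> eta; apply: cvgMl_tmp; exact: cvp.
  - apply: (poly_growth_integrable p0 p1 hrho); apply: poly_growthM => //.
    have [mh [K [D hK]]] := pg_h; split; first exact: measurableT_comp.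
    by exists K, D => eta; rewrite normr_id.
  - move=> n eta; rewrite normrM ler_wpM2l //; apply: power_integral_bound => //.
    by have [[]] := gf n.
suff cv0 : \int[rho]_eta (h eta * power_integral (f_ n) eta) @[n --> \oo] --> 0.
  exact: (cvg_unique _ cvi cv0).
rewrite (_ : (fun n => _) = cst 0); first exact: cvg_cst.
by apply/funext => n; have [] := gf n.
Qed.

Let good_rectangle (A : nat -> set E) : (forall i, measurable (A i)) ->
  good (\1_(rectangle k A)).
Proof.
move=> mA.
have E1 : power_integral (\1_(rectangle k A)) =
    fun eta => \prod_(i < k) count_in (A i) eta :> R.
  by apply/funext => eta; exact: power_integral_rectangle.
split; first by apply: bounded_measurable_indic; exact: measurable_rectangle.
  by rewrite E1; apply: poly_growth_prod => i; exact: poly_growth_count.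
by rewrite E1; exact: h_rect.
Qed.

Let good_indicT : good (\1_setT).
Proof.
have -> : [set: k.-tuple E] = rectangle k (fun=> setT) by apply/seteqP; split.
exact: good_rectangle.
Qed.

Let good0 : good (cst 0).
Proof.
have := goodZ 0 good_indicT.
by under eq_fun do rewrite mul0r.
Qed.

Let good_indic U : measurable U -> good (\1_U).
Proof.
rewrite tuple_measurableE; move: U; apply: dynkin_induction.
- exact: tuple_measurableE.
- exact: setI_closed_rectangle.
- exact: good_indicT.
- by move=> _ [A mA <-]; exact: good_rectangle.
- move=> S mS gS; have := goodD good_indicT (goodZ (-1) gS).
  rewrite (_ : (fun x => _) = \1_(~` S)) //.
  apply/funext => x; rewrite !indicE in_setT in_setC.
  by case: (x \in S) => /=; ring.
move=> F mF tF gF.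
(* By disjointness the partial sums of indicators take only the values 0 and 1, which gives the
   uniform bound required by [good_lim]. *)
have Ein m x j : F j x -> \sum_(i < m) \1_(F i) x = (j < m)%:R :> R.
  move=> Fj; have Fi i : i != j -> \1_(F i) x = 0 :> R.
    move=> /eqP ij; rewrite indicE memNset // => Fi; apply: ij; apply: tF => //.
    by exists x.
  case: ltnP => jm; last first.
    by rewrite big1 // => i _; apply: Fi; rewrite neq_ltn (leq_trans _ jm).
  rewrite (bigD1 (Ordinal jm)) //= big1 ?addr0 ?indicE ?mem_set //.
  by move=> i; rewrite -val_eqE /=; exact: Fi.
have Eout m x : ~ (\bigcup_k F k) x -> \sum_(i < m) \1_(F i) x = 0 :> R.
  move=> nF; rewrite big1 // => i _; rewrite indicE memNset // => Fi.
  by apply: nF; exists i.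
apply: (@good_lim (fun m x => \sum_(i < m) \1_(F i) x) _ 1).
- by move=> m; exact: (@good_sum m (fun i => \1_(F i)) (fun i => gF i) good0).
- move=> m x; have [[j _ Fj]|nF] := pselect ((\bigcup_k F k) x).
    by rewrite (Ein _ _ _ Fj) normr_nat lern1 leq_b1.
  by rewrite Eout // normr0.
- move=> x; have [[j _ Fj]|nF] := pselect ((\bigcup_k F k) x).
    apply: cvg_near_cst; exists j.+1 => // m /= jm.
    by rewrite (Ein _ _ _ Fj) jm indicE mem_set //; exists j.
  apply: cvg_near_cst; apply: nearW => m.
  by rewrite Eout // indicE memNset.
Qed.

Import HBNNSimple.

Let good_nnsfun (u : {nnsfun k.-tuple E >-> R}) : good u.
Proof.
pose s : seq R := finmap.enum_fset (fset_set (u @` setT)).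
have gs i : good (fun x => s`_i * \1_(u @^-1` [set s`_i]) x).
  by apply: goodZ; exact: good_indic.
have g1 := @good_sum (size s) _ (fun i => gs i) good0.
suff <- : (fun x => \sum_(i < size s) s`_i * \1_(u @^-1` [set s`_i]) x) = u by exact: g1.
by apply/funext => x; apply/esym; exact: fimfunEord.
Qed.

Lemma bounded_measurable_power_integral f : bounded_measurable f ->
  poly_growth (power_integral f) /\ \int[rho]_eta (h eta * power_integral f eta) = 0.
Proof.
move=> [mf [C fC]]; suff [] : good f by [].
have good_nneg g : (forall x, 0 <= g x) -> measurable_fun setT g ->
    (forall x, g x <= C + C) -> good g.
  move=> g0 mg gC.
  have mEg : measurable_fun setT (EFin \o g) by exact/measurable_EFinP.
  have g0' : forall x, setT x -> (0 <= (EFin \o g) x)%E by move=> x _; rewrite lee_fin.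
  pose g_ := nnsfun_approx measurableT mEg.
  apply: (@good_lim (fun n => g_ n) _ (C + C)).
  - by move=> n; exact: good_nnsfun.
  - move=> n x; rewrite ger0_norm //; apply: le_trans (gC x).
    by have := le_approx n g0' (I : setT x); rewrite lee_fin /g_ nnsfun_approxE.
  - move=> x; have := cvg_nnsfun_approx measurableT mEg g0' (I : setT x).
    by move=> /fine_cvg.
(* Adding the bound [C] gives values between [0] and [C + C], so that the sum is a bounded limit of
   simple functions. *)
have -> : f = fun x => (f x + C) + (- C) * \1_setT x.
  by apply/funext => x; rewrite indicE in_setT mulr1 addrK.
apply: goodD; last exact: goodZ.
apply: good_nneg.
- by move=> x; have := fC x; rewrite ler_norml => /andP[]; rewrite -subr_ge0 opprK.
- exact: measurable_funD.
- by move=> x; rewrite lerD2r; exact: le_trans (ler_norm _) (fC x).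
Qed.

End monotone_class.

(** * Orthogonality and projections in L^2 *)

Section L2_theory.
Context d (T : measurableType d) (R : realType) (mu : {measure set T -> \bar R}).
Implicit Types (f g h : T -> R) (M : set (T -> R)).
Local Notation L2 := (Lfun mu 2%:E).

Let one_le_two : (1 <= 2%:E :> \bar R)%E.
Proof. by rewrite lee_fin ler1n. Qed.

Lemma Lfun2B f g : f \in L2 -> g \in L2 -> (fun x => f x - g x) \in L2.
Proof.
move=> f2 g2; have := (Lfun_addr_closed mu one_le_two).2 f (- g) f2.
by apply; exact: Lfun_oppr_closed.
Qed.

Lemma Lfun2_integrableM f g : f \in L2 -> g \in L2 ->
  mu.-integrable setT (EFin \o (fun x => f x * g x)).
Proof. by move=> f2 g2; apply/Lfun1_integrable; exact: Lfun2_mul_Lfun1. Qed.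

Lemma Lfun2_cauchy_schwarz f g : f \in L2 -> g \in L2 ->
  ((`|\int[mu]_x (f x * g x)|)%:E <= 'N[mu]_2%:E[EFin \o f] * 'N[mu]_2%:E[EFin \o g])%E.
Proof.
move=> f2 g2; have mf : measurable_fun setT f by move: f2; rewrite inE => /andP[/[!inE]].
have mg : measurable_fun setT g by move: g2; rewrite inE => /andP[/[!inE]].
have intfg := Lfun2_integrableM f2 g2.
apply: (@le_trans _ _ ('N[mu]_1[EFin \o (f \* g)%R])%E).
  rewrite Lnorm1 EFin_normr_Rintegral //.
  exact: le_abse_integral (measurable_int _ intfg).
by apply: hoelder => //; rewrite [RHS]splitr !div1r.
Qed.

Lemma subset_L2_closure M f : M f -> f \in L2 -> L2_closure mu M f.
Proof.
move=> Mf f2; split => // e e0; exists f => //.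
rewrite (_ : EFin \o _ = cst 0%E); last by apply/funext => x /=; rewrite subrr.
by rewrite Lnorm0 // lte_fin.
Qed.

Lemma L2_orthogonal_closure M h : (forall g, M g -> g \in L2) ->
  L2_orthogonal mu M h -> L2_orthogonal mu (L2_closure mu M) h.
Proof.
move=> M2 [h2 hM]; split => // g [g2 gM].
have fin_h : ('N[mu]_2%:E[EFin \o h] < +oo)%E.
  by move: h2; rewrite inE => /andP[_ /[!inE]].
pose K := fine 'N[mu]_2%:E[EFin \o h]%E.
have K0 : 0 <= K by apply: fine_ge0; exact: Lnorm_ge0.
have NK : ('N[mu]_2%:E[EFin \o h] = K%:E)%E by rewrite fineK // ge0_fin_numE // Lnorm_ge0.
apply/eqP; rewrite -normr_le0; apply/ler_addgt0Pl => e e0; rewrite addr0.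
have K1 : 0 < K + 1 by rewrite ltr_wpDl.
(* Since [u] is orthogonal to [h], [g] may be replaced by [g - u]. The radius makes the
   Cauchy-Schwarz bound at most [e]; [K + 1] covers the case [K = 0]. *)
have [u Mu Nu] := gM (e / (K + 1)) (divr_gt0 e0 K1).
have u2 := M2 _ Mu.
have -> : \int[mu]_x (h x * g x) = \int[mu]_x (h x * (g x - u x)).
  under [RHS]eq_Rintegral do rewrite mulrBr.
  by rewrite RintegralB ?(hM _ Mu) ?subr0 //; exact: Lfun2_integrableM.
rewrite -lee_fin; apply: le_trans (Lfun2_cauchy_schwarz h2 (Lfun2B g2 u2)) _.
rewrite NK; apply: (@le_trans _ _ (K%:E * (e / (K + 1))%:E)%E).
  by apply: lee_wpmul2l; [rewrite lee_fin|exact: ltW].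
rewrite -EFinM lee_fin mulrCA ler_piMr //; first exact: ltW.
by rewrite ler_pdivrMr // mul1r lerDl.
Qed.

(** The difference [D] of the projections lies in the orthogonal complement of [K], to which both
    [f - h1] and [f - h2] are orthogonal; hence the integral of [D * D] vanishes. *)
Lemma L2_projection_unique K f h1 h2 : (forall g, K g -> g \in L2) -> f \in L2 ->
  L2_projection mu (L2_orthogonal mu K) f h1 ->
  L2_projection mu (L2_orthogonal mu K) f h2 -> {ae mu, forall x, h1 x = h2 x}.
Proof.
move=> K2 f2 [[h12 h1K] [r1 o1]] [[h22 h2K] [r2 o2]].
pose D x := h1 x - h2 x.
have D2 : D \in L2 by exact: Lfun2B.
have oD : L2_orthogonal mu K D.
  split => // g Kg; under eq_Rintegral do rewrite mulrBl.
  by rewrite RintegralB ?h1K ?h2K ?subrr //; apply: Lfun2_integrableM => //; exact: K2.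
have DD : \int[mu]_x (D x * D x) = 0.
  rewrite -[RHS](subrr 0) -{1}(o2 D oD) -(o1 D oD).
  rewrite -RintegralB //; try exact: Lfun2_integrableM.
  by apply: eq_Rintegral => x _; rewrite /D; ring.
have intD := Lfun2_integrableM D2 D2.
have : (\int[mu]_x `|(D x * D x)%:E| = 0)%E.
  under eq_integral do rewrite gee0_abs ?lee_fin -?expr2 ?sqr_ge0 //.
  rewrite -[LHS]fineK; last by apply: integrable_fin_num.
  by congr EFin; rewrite -[RHS]DD; apply: eq_Rintegral => x _; rewrite expr2.
move/(ae_eq_integral_abs mu measurableT (measurable_int _ intD)).
apply: filterS => x /(_ I) /= /eqP; rewrite eqe mulf_eq0 orbb subr_eq0.
by move=> /eqP.
Qed.

End L2_theory.

(** * Linear spans *)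

Section spans.
Context (T : Type) (R : realType).
Implicit Types (S : set (T -> R)) (f g u : T -> R).

(** An inductive form of [linear_combinations]: closure properties follow by induction instead of by
    reindexing finite families. *)
Inductive span S : (T -> R) -> Prop :=
| span_zero : span S (fun=> 0)
| span_step c u g : S u -> span S g -> span S (fun x => c * u x + g x).

Lemma span_eq S f g : f =1 g -> span S f -> span S g.
Proof. by move=> /funext ->. Qed.

Lemma spanD S f g : span S f -> span S g -> span S (fun x => f x + g x).
Proof.
move=> + Sg; elim=> [|c u {}f Su _ IH]; first by apply: span_eq Sg => x; rewrite add0r.
by apply: span_eq (span_step c Su IH) => x; rewrite addrA.
Qed.

Lemma spanZ S c f : span S f -> span S (fun x => c * f x).
Proof.
elim=> [|c' u {}f Su _ IH].
  by apply: span_eq (span_zero S) => x; rewrite mulr0.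
by apply: span_eq (span_step (c * c') Su IH) => x; rewrite mulrDr mulrA.
Qed.

Lemma spanB S f g : span S f -> span S g -> span S (fun x => f x - g x).
Proof.
move=> Sf Sg; have := spanD Sf (spanZ (-1) Sg).
by apply: span_eq => x; rewrite mulN1r.
Qed.

Lemma span_mem S f : S f -> span S f.
Proof.
by move=> Sf; apply: span_eq (span_step 1 Sf (span_zero S)) => x; rewrite mul1r addr0.
Qed.

Lemma span_sum S (I : eqType) (s : seq I) (f : I -> T -> R) :
  (forall i, i \in s -> span S (f i)) -> span S (fun x => \sum_(i <- s) f i x).
Proof.
elim: s => [|i s IH] Sf.
  by apply: span_eq (span_zero S) => x; rewrite big_nil.
have Si := Sf i (mem_head _ _).
have Ss : span S (fun x => \sum_(j <- s) f j x).
  by apply: IH => j js; apply: Sf; rewrite inE js orbT.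
by apply: span_eq (spanD Si Ss) => x; rewrite big_cons.
Qed.

Lemma sub_span S S' f : S `<=` S' -> span S f -> span S' f.
Proof.
move=> SS'; elim=> [|c u {}f Su _ IH]; first exact: span_zero.
by apply: span_step => //; exact: SS'.
Qed.

Lemma spanM S S' S'' f g :
  (forall u v, S u -> S' v -> S'' (fun x => u x * v x)) ->
  span S f -> span S' g -> span S'' (fun x => f x * g x).
Proof.
move=> SS Sf Sg; elim: Sf => [|c u {}f Su _ IH].
  by apply: span_eq (span_zero S'') => x; rewrite mul0r.
have Sug : span S'' (fun x => u x * g x).
  elim: Sg {IH} => [|c' v {}g Sv _ IH].
    by apply: span_eq (span_zero S'') => x; rewrite mulr0.
  by apply: span_eq (span_step c' (SS _ _ Su Sv) IH) => x; ring.
by apply: span_eq (spanD (spanZ c Sug) IH) => x; ring.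
Qed.

Lemma span_linear_combinations S f : span S f -> linear_combinations S f.
Proof.
elim=> [|c u {}f Su _ [m [c' [v [Sv ->]]]]].
  exists 0%N, (fun=> 0), (fun=> cst 0); split => [[]//|].
  by apply/funext => x; rewrite big_ord0.
exists m.+1, (fun i => oapp c' c (unlift ord0 i)), (fun i => oapp v u (unlift ord0 i)).
split; first by move=> i; case: unliftP => [j _|_] /=; [exact: Sv|exact: Su].
apply/funext => x; rewrite big_ord_recl unlift_none; congr (_ + _).
by apply: eq_bigr => i _; rewrite liftK.
Qed.

End spans.

(** * Polynomials in counts and their leading terms *)

Section count_polynomials.
Context d (E : measurableType d) (R : realType).
Local Notation N := (nmeasure E R).
Implicit Types (B : set E) (eta : N) (f g : N -> R).

(** The bound is strict, so index [n] means degree less than [n] and the span for [n = 0] is zero. A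
    difference of two monic polynomials of degree [n] in a count then has index [n]. *)
Definition count_monomials n : set (N -> R) :=
  [set g | exists k (A : nat -> set E), [/\ (k < n)%N, forall i, measurable (A i) &
    g = fun eta => \prod_(i < k) count_in (A i) eta]].

Definition count_polynomial n : (N -> R) -> Prop := span (count_monomials n).

Lemma sub_count_polynomial n n' f : (n <= n')%N ->
  count_polynomial n f -> count_polynomial n' f.
Proof.
move=> nn'; apply: sub_span => _ [k [A [kn mA ->]]].
by exists k, A; split => //; exact: leq_trans kn nn'.
Qed.

Lemma count_polynomial_cst n c : count_polynomial n.+1 (fun=> c).
Proof.
have M1 : count_monomials n.+1 (fun=> 1).
  by exists 0%N, (fun=> setT); split => //; apply/funext => eta; rewrite big_ord0.
by apply: span_eq (spanZ c (span_mem M1)) => eta; rewrite mulr1.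
Qed.

Lemma count_polynomial_count n B : measurable B -> count_polynomial n.+2 (count_in B).
Proof.
move=> mB; apply: span_mem; exists 1%N, (fun=> B); split => //.
by apply/funext => eta; rewrite big_ord1.
Qed.

Lemma count_polynomialM n n' f g : count_polynomial n.+1 f -> count_polynomial n' g ->
  count_polynomial (n + n') (fun eta => f eta * g eta).
Proof.
apply: spanM => _ _ [k [A [kn mA ->]]] [k' [A' [kn' mA' ->]]].
exists (k + k')%N, (fun i => if (i < k)%N then A i else A' (i - k)%N); split.
- by rewrite -addnS leq_add.
- by move=> i; case: ifP.
apply/funext => eta; rewrite big_split_ord; congr (_ * _); apply: eq_bigr => i _ /=.
  by rewrite ltn_ord.
by rewrite ltnNge leq_addr addKn.
Qed.

Lemma count_polynomialX B k : measurable B ->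
  count_polynomial k.+1 (fun eta => count_in B eta ^+ k).
Proof.
move=> mB; apply: span_mem; exists k, (fun=> B); split => //.
by apply/funext => eta; rewrite prodr_const card_ord.
Qed.

(** Both claims are proved together: with [x] the count, the difference at [k.+1] is [x] times the
    difference at [k], minus [k] times the falling factorial at [k]. *)
Lemma count_polynomial_falling B k : measurable B ->
  count_polynomial k (fun eta => falling (count_in B eta) k - count_in B eta ^+ k) /\
  count_polynomial k.+1 (fun eta => falling (count_in B eta) k).
Proof.
move=> mB; elim: k => [|k [IHd IH]].
  split.
    apply: span_eq (span_zero _) => eta; by rewrite /falling big_ord0 subrr.
  apply: span_eq (count_polynomial_cst 0 1) => eta; by rewrite /falling big_ord0.
have Hd : count_polynomial k.+1
    (fun eta => falling (count_in B eta) k.+1 - count_in B eta ^+ k.+1).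
  have Hx := count_polynomialM (count_polynomial_count 0 mB) IHd.
  have := spanB Hx (spanZ k%:R IH).
  by apply: span_eq => eta; rewrite falling_recr exprS; ring.
split => //.
have := spanD (sub_count_polynomial (leqnSn _) Hd) (count_polynomialX k.+1 mB).
by apply: span_eq => eta; rewrite subrK.
Qed.

Lemma count_polynomial_meixner B k a p : measurable B ->
  count_polynomial k (fun eta => meixner k (count_in B eta) a p - count_in B eta ^+ k) /\
  count_polynomial k.+1 (fun eta => meixner k (count_in B eta) a p).
Proof.
move=> mB.
have Hd : count_polynomial k
    (fun eta => meixner k (count_in B eta) a p - count_in B eta ^+ k).
  (* The coefficients below the top one; the top coefficient is [1]. *)
  pose c (i : nat) := 'C(k, i)%:R * (1 - p^-1)^-1 ^+ (k - i) * rising (a + i%:R) (k - i).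
  have Hs : count_polynomial k
      (fun eta => \sum_(i <- index_enum 'I_k) c i * falling (count_in B eta) i).
    apply: span_sum => i _; apply: spanZ.
    exact: sub_count_polynomial (ltn_ord i) (count_polynomial_falling i mB).2.
  have := spanD Hs (count_polynomial_falling k mB).1.
  apply: span_eq => eta; rewrite meixnerE big_ord_recr /= addrA; congr (_ - _).
  by congr (_ + _); rewrite binn subnn expr0 /rising big_ord0 !mul1r.
split => //.
have := spanD (sub_count_polynomial (leqnSn _) Hd) (count_polynomialX k mB).
by apply: span_eq => eta; rewrite subrK.
Qed.

(** Telescoping: with [x] a count to its power, [M] its Meixner factor, and [P], [Q] the products
    over the tail, [x P - M Q = x (P - Q) - Q (M - x)], and both differences have lower degree. *)
Lemma count_polynomial_prod_meixner (I : Type) (s : seq I) (B : I -> set E)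
    (dd : I -> nat) (a : I -> R) p : (forall i, measurable (B i)) ->
  count_polynomial (\sum_(i <- s) dd i)
    (fun eta => \prod_(i <- s) count_in (B i) eta ^+ dd i -
                \prod_(i <- s) meixner (dd i) (count_in (B i) eta) (a i) p).
Proof.
move=> mB; pose Q s eta := \prod_(i <- s) meixner (dd i) (count_in (B i) eta) (a i) p.
have HQ l : count_polynomial (\sum_(i <- l) dd i).+1 (Q l).
  elim: l => [|i l IH].
    apply: span_eq (count_polynomial_cst _ 1) => eta; by rewrite /Q big_nil.
  rewrite big_cons -addnS.
  have Hi := (count_polynomial_meixner (dd i) (a i) p (mB i)).2.
  apply: span_eq (count_polynomialM Hi IH) => eta.
  by rewrite /Q big_cons.
elim: s => [|i s IH].
  by apply: span_eq (span_zero _) => eta; rewrite !big_nil subrr.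
rewrite big_cons.
have H1 := count_polynomialM (count_polynomialX (dd i) (mB i)) IH.
have H2 := count_polynomialM (HQ s) (count_polynomial_meixner (dd i) (a i) p (mB i)).1.
rewrite addnC in H2.
by apply: span_eq (spanB H1 H2) => eta; rewrite !big_cons /Q; ring.
Qed.

Lemma count_polynomial_polynomials n f : count_polynomial n.+1 f -> polynomials n f.
Proof.
move=> pf; apply: span_linear_combinations; apply: sub_span pf => _ [k [A [kn mA ->]]].
exists k, (\1_(rectangle k A)); split => //.
  by apply: bounded_measurable_indic; exact: measurable_rectangle.
by apply/funext => eta; rewrite power_integral_rectangle.
Qed.

End count_polynomials.

(** * Indicators of blocks *)

Section blocks.
Context d (E : measurableType d) (R : realType).
Local Notation N := (nmeasure E R).
Variables (M : nat) (B : 'I_M -> set E) (dd : 'I_M -> nat).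
Hypothesis mB : forall k, measurable (B k).

Lemma measurable_blocks i : measurable (nth set0 (blocks B dd) i).
Proof.
have [lt_i|?] := ltnP i (size (blocks B dd)); last by rewrite nth_default.
move: (mem_nth set0 lt_i); move: (nth _ _ _) => U /flattenP[l /mapP[k _ ->]].
by move=> /nseqP[-> _].
Qed.

Lemma size_blocks : size (blocks B dd) = (\sum_(k < M) dd k)%N.
Proof.
rewrite size_flatten /shape -map_comp sumnE big_map -[RHS]big_enum /=.
by apply: eq_bigr => k _; rewrite size_nseq.
Qed.

Lemma block_indicE n : block_indic R B dd =
  \1_(rectangle n (fun i => nth set0 (blocks B dd) i)) :> (n.-tuple E -> R).
Proof.
apply/funext => x; rewrite /block_indic /tensor indicE.
have [/set_mem xr|/negP xr] := boolP (x \in _).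
  by rewrite big1 // => i _; rewrite indicE mem_set //; exact: xr.
have [i ni] : exists i : 'I_n, ~ nth set0 (blocks B dd) i (tnth x i).
  by apply/existsNP => H; apply: xr; apply/mem_set => i; exact: H.
by rewrite (bigD1 i) //= indicE memNset // mul0r.
Qed.

Lemma power_integral_block_indic n (eta : N) : (\sum_(k < M) dd k)%N = n ->
  power_integral (block_indic R B dd : n.-tuple E -> R) eta =
  \prod_(k < M) count_in (B k) eta ^+ dd k.
Proof.
move=> hn; rewrite block_indicE power_integral_rectangle; last exact: measurable_blocks.
rewrite -hn -size_blocks.
transitivity (\prod_(U <- blocks B dd) count_in U eta).
  by rewrite (big_nth set0) big_mkord.
rewrite /blocks big_flatten /= big_map -[RHS]big_enum /=.
by apply: eq_bigr => k _; rewrite big_nseq iter_mulr_1.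
Qed.

End blocks.

(** * Orthogonality of the Meixner product to polynomials of lower degree *)

Section orthogonality.
Context d (E : measurableType d) (R : realType).
Local Notation N := (nmeasure E R).
Variables (alpha : {finite_measure set E -> \bar R}) (p : R) (rho : probability N R).
Hypotheses (p0 : 0 < p) (p1 : p < 1) (hrho : pascal_distribution alpha p rho).
Variables (M : nat) (B : 'I_M -> set E) (dd : 'I_M -> nat).
Hypotheses (mB : forall k, measurable (B k)) (disjB : trivIset [set: 'I_M] B).

Let h (eta : N) :=
  \prod_(k < M) meixner (dd k) (count_in (B k) eta) (fine (alpha (B k))) p.

Lemma poly_growth_prod_meixner : poly_growth h.
Proof. by apply: poly_growth_prod => k; exact: poly_growth_meixner. Qed.

Lemma prod_meixner_set_product_eq0 k (A : nat -> set E) : (forall i, measurable (A i)) ->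
  (k < \sum_(i < M) dd i)%N ->
  \int[rho]_eta (h eta * \prod_(i < k) count_in (A i) eta) = 0.
Proof.
move=> mA kn.
(* The complement of the union completes the [B j] to a partition; with degree [0] its Meixner
   factor is [1]. *)
pose C (i : 'I_M.+1) := if unlift ord0 i is Some j then B j else ~` \bigcup_j B j.
pose e (i : 'I_M.+1) := if unlift ord0 i is Some j then dd j else 0%N.
have mU : measurable (\bigcup_j B j) by exact: fin_bigcup_measurable.
have mC i : measurable (C i).
  by rewrite /C; case: unliftP => [j _|_] //; exact: measurableC.
have tC : trivIset setT C.
  move=> i1 i2 _ _; rewrite /C.
  case: unliftP => [a ->|->]; case: unliftP => [b ->|->] // [x []].
  - by move=> Ba Bb; rewrite (disjB (i := a) (j := b)) //; exists x.
  - by move=> Ba []; exists a.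
  - by move=> nB Bb; exfalso; apply: nB; exists b.
have cC : \bigcup_i C i = setT.
  rewrite -subTset => x _; have [[j _ Bj]|nB] := pselect ((\bigcup_j B j) x).
    by exists (lift ord0 j) => //; rewrite /C liftK.
  by exists ord0 => //; rewrite /C unlift_none.
have := pascal_meixner_set_product_eq0 p0 p1 hrho mA (k := k) (e := e) (m := fun=> 0%N)
  mC tC cC.
rewrite big1 // add0n big_ord_recl {1}/e unlift_none add0n.
under eq_bigr do rewrite /e liftK.
move=> /(_ kn) <-; apply: eq_Rintegral => eta _; congr (_ * _).
rewrite big_ord_recl {1}/e unlift_none meixner0 expr0 !mul1r.
by apply: eq_bigr => i _; rewrite /e /C liftK mulr1.
Qed.

Lemma poly_growth_polynomials m (g : N -> R) : polynomials m g -> poly_growth g.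
Proof.
move=> [l [c [u [pu ->]]]]; apply: poly_growth_sum => i; apply: poly_growthM.
  exact: poly_growth_cst.
have [k [f [_ bf ->]]] := pu i.
(* Only the growth and measurability of the power integral are wanted: h = 0. *)
have := @bounded_measurable_power_integral _ _ _ _ _ _ p0 p1 hrho k (cst 0)
  (@poly_growth_cst _ E R 0).
have H0 (A : nat -> set E) : (forall i, measurable (A i)) ->
    \int[rho]_eta (cst 0 eta * \prod_(i < k) count_in (A i) eta) = 0.
  move=> _; under eq_Rintegral do rewrite mul0r.
  by rewrite Rintegral_cst // mul0r.
by move=> /(_ H0 _ bf)[].
Qed.

Lemma prod_meixner_polynomials_eq0 m (g : N -> R) :
  (m < \sum_(i < M) dd i)%N -> polynomials m g ->
  \int[rho]_eta (h eta * g eta) = 0.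
Proof.
move=> mn [l [c [u [pu ->]]]].
have pgu i : poly_growth (u i) /\ \int[rho]_eta (h eta * u i eta) = 0.
  have [k [f [km bf ->]]] := pu i.
  have hk (A : nat -> set E) : (forall i, measurable (A i)) ->
      \int[rho]_eta (h eta * \prod_(i < k) count_in (A i) eta) = 0.
    by move=> mA; apply: prod_meixner_set_product_eq0 => //; exact: leq_ltn_trans mn.
  exact: (bounded_measurable_power_integral p0 p1 hrho poly_growth_prod_meixner hk bf).
have pgh i : rho.-integrable setT (EFin \o (fun eta => h eta * u i eta)).
  apply: (poly_growth_integrable p0 p1 hrho); apply: poly_growthM (pgu i).1.
  exact: poly_growth_prod_meixner.
under eq_Rintegral do rewrite mulr_sumr.
under eq_Rintegral do under eq_bigr do rewrite mulrCA.
rewrite Rintegral_sum; last first.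
  by move=> i; have := integrableZl measurableT (c i) (pgh i).
by rewrite big1 // => i _; rewrite RintegralZl // (pgu i).2 mulr0.
Qed.

End orthogonality.

(** * Identification of the projection *)

Theorem proposition5p3 (R : realType) (d : measure_display)
    (E : measurableType d) (hE : borel_space R E)
    (alpha : {finite_measure set E -> \bar R})
    (halpha : alpha [set: E] <> 0%E)
    (p : R) (hp0 : 0 < p) (hp1 : p < 1)
    (rho : probability (nmeasure E R) R)
    (hrho : pascal_distribution alpha p rho)
    (N : nat) (hN : (0 < N)%N)
    (B : 'I_N -> set E) (mB : forall k, measurable (B k))
    (disjB : trivIset [set: 'I_N] B)
    (n : nat) (dd : 'I_N -> nat) (hn : (\sum_(k < N) dd k)%N = n) :
  {ae rho, forall eta : nmeasure E R,
    orthogonal_polynomial (n := n) rho (block_indic R B dd) eta =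
    \prod_(k < N) meixner (dd k) (fine (eta (B k))) (fine (alpha (B k))) p}.
Proof.
case: n hn => [|m] hn.
  (* For [n = 0] all exponents vanish, so the tensor product is empty and every Meixner factor is
     [1]. *)
  have dd0 k : dd k = 0%N.
    by apply/eqP; rewrite -leqn0 -[X in (_ <= X)%N]hn (bigD1 k) //= leq_addr.
  apply: aeW => eta /=; rewrite /block_indic /tensor big_ord0 big1 // => k _.
  by rewrite dd0 meixner0.
pose f : nmeasure E R -> R := power_integral (block_indic R B dd : m.+1.-tuple E -> R).
pose h eta := \prod_(k < N) meixner (dd k) (count_in (B k) eta) (fine (alpha (B k))) p.
pose K := L2_closure rho (polynomials m : set (nmeasure E R -> R)).
have K2 g : K g -> g \in Lfun rho 2%:E by case.
have L2 (g : nmeasure E R -> R) : poly_growth g -> g \in Lfun rho 2%:E.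
  exact: (poly_growth_Lfun2 hp0 hp1 hrho).
have pg_h : poly_growth h by exact: poly_growth_prod_meixner.
have fE : f = fun eta => \prod_(k < N) count_in (B k) eta ^+ dd k.
  by apply/funext => eta; exact: power_integral_block_indic.
have pg_f : poly_growth f.
  rewrite fE; apply: poly_growth_prod => k.
  by apply: poly_growthX; exact: poly_growth_count.
(* The leading terms of [f] and [h] agree, so the difference has degree at most [m]. *)
have fhP : polynomials m (fun eta => f eta - h eta).
  apply: count_polynomial_polynomials; rewrite fE -hn.
  exact: count_polynomial_prod_meixner.
(* [h] is orthogonal to the closure [K], and [f - h] belongs to [K], hence is orthogonal to its
   complement. *)
have projh : L2_projection rho (L2_orthogonal rho K) f h.
  split.
    apply: L2_orthogonal_closure.
      by move=> g /(poly_growth_polynomials hp0 hp1 hrho); exact: L2.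
    split; first exact: L2.
    by move=> g; apply: (prod_meixner_polynomials_eq0 hp0 hp1 hrho) => //; rewrite hn.
  have fh2 : (fun eta => f eta - h eta) \in Lfun rho 2%:E by apply: Lfun2B; exact: L2.
  split => // g [g2 gK]; under eq_Rintegral do rewrite mulrC.
  by apply: gK; exact: subset_L2_closure.
(* The existence of the projection [h] ensures that [xget] returns a projection and not its default,
   and two projections agree almost everywhere. *)
apply: (L2_projection_unique K2 (L2 _ pg_f) _ projh).
exact: (@xgetPex _ (cst 0) [set h | L2_projection rho (L2_orthogonal rho K) f h]
  (ex_intro _ h projh)).
Qed.
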